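(* Let $P$ be the transition kernel of a $\pi$-irreducible Markov chain that is reversible with respect to its invariant probability measure $\pi$. Assume that there exists a set $A\in\mathscr{B}(X)$ with $\pi(A)>0$ such that, for some constant $\delta>0$ and some probability measure $\nu$ on $\mathscr{B}(X)$, $$P(x,B)\ge\delta 1_A(x)\nu(B),\qquad x\in X,\ B\in\mathscr{B}(X),$$ and $M:=\sup_{x\in X}\mathbb{E}_x[\sigma_A]<\infty$. Then for all $1<\lambda<e^{1/M}$ satisfying $$\sup_{x\in A}\sum_{n=1}^{\infty}\lambda^{2n}F^{2n}(x,A)\le\vartheta\qquad\text{and}\qquad \lambda^2<(1-\vartheta)(1-M\log\lambda)^2\bigl(1+\delta^2\nu(A)\lambda^2\bigr)$$ for some $\vartheta<1$, one has (for all $n$) $$\|P^n-\pi\|\le(D_3+E_3n)\lambda^{-n},$$ where $$D_3=C_3\lambda+(2-C_3)^+\lambda^{-1}M_3,\qquad E_3=C_3(\lambda-\lambda^{-1})M_3/2,$$ $$C_3=\bigl((\delta^2\nu(A)\pi(A))^{-1}-1\bigr)^{1/2},\qquad M_3=\frac{\delta^2\nu(A)\lambda^2}{(1-\vartheta)(1-M\log\lambda)^2(1+\delta^2\nu(A)\lambda^2)-\lambda^2}.$$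
   Context: $\Phi=\{\Phi_n:n\in\mathbb{Z}_+\}$ is a discrete-time homogeneous Markov chain on a general state space $X$ with countably generated $\sigma$-field $\mathscr{B}(X)$ and $n$-step transition kernel $P^n(x,B)=\mathbb{P}_x\{\Phi_n\in B\}$; $\mathbb{P}_x,\mathbb{E}_x$ are probability and expectation given $\Phi_0=x$. The chain has a (unique) invariant probability measure $\pi$ and is $\pi$-irreducible: if $\pi(B)>0$, there exists $n\in\mathbb{N}$ such that $P^n(x,B)>0$ for all $x\in X$. It is assumed that $P^n(x,\cdot)\ll\pi$ ($n\ge1$), with density $p^n(x,y)$. Reversible: $\pi(dx)P(x,dy)=\pi(dy)P(y,dx)$. $\sigma_A=\inf\{n\ge0:\Phi_n\in A\}$, $\tau_A=\inf\{n\ge1:\Phi_n\in A\}$, $F^n(x,A)=\mathbb{P}_x\{\tau_A=n\}$. $\|P^n-\pi\|=\sup_{x\in X}\|P^n(x,\cdot)-\pi\|_{\mathrm{Var}}$, where $\|\mu\|_{\mathrm{Var}}=\sup_{|f|\le1}|\mu(f)|$ for a signed measure $\mu$. $a^+=\max\{a,0\}$. *)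

(* Defs.v *)
From HB Require Import structures.
From mathcomp Require Import all_boot all_order all_algebra.
From mathcomp Require Import all_classical all_reals all_analysis.

Set Implicit Arguments.
Unset Strict Implicit.
Unset Printing Implicit Defensive.

Import Order.TTheory GRing.Theory Num.Theory.
Import numFieldNormedType.Exports.

Local Open Scope classical_set_scope.
Local Open Scope ring_scope.

Definition countably_generated (d : measure_display) (X : measurableType d) :
    Prop :=
  exists G : set (set X), countable G /\ @measurable d X = <<s G >>.

Section MarkovChain.
Context (R : realType) (d dW : measure_display).
Context (X : measurableType d) (W : measurableType dW).

Definition natural_filtration (Phi : nat -> {mfun W >-> X}) (n : nat) :
    set (set W) :=
  <<s [set E : set W | exists i : nat, exists B : set X,
         [/\ (i <= n)%N, measurable B & E = Phi i @^-1` B]] >>.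

(* Phi_0 = x is expressed through the law of Phi_0, because {x} need not be
   measurable.  The second clause says that P(Phi_n, B) is a version of the
   conditional probability of {Phi_{n+1} \in B} given Phi_0, ..., Phi_n. *)
Definition markov_chain (P : R.-pker X ~> X) (Pr : X -> probability W R)
    (Phi : nat -> {mfun W >-> X}) : Prop :=
  forall x : X,
    (forall B : set X, measurable B -> Pr x (Phi 0%N @^-1` B) = \d_x B) /\
    (forall (n : nat) (E : set W) (B : set X),
       natural_filtration Phi n E -> measurable B ->
       Pr x (E `&` Phi n.+1 @^-1` B) =
         (\int[Pr x]_(w in E) P (Phi n w) B)%E).

Definition nstep (Pr : X -> probability W R) (Phi : nat -> {mfun W >-> X})
    (n : nat) (x : X) : probability X R :=
  distribution (Pr x) (Phi n).

Definition pi_irreducible (Pr : X -> probability W R)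
    (Phi : nat -> {mfun W >-> X}) (pi : probability X R) : Prop :=
  forall B : set X, measurable B -> (0 < pi B)%E ->
  forall x : X, exists2 n : nat, (0 < n)%N & (0 < nstep Pr Phi n x B)%E.

(* The infimum of the empty set is +oo. *)
Definition sigma_hit (Phi : nat -> {mfun W >-> X}) (A : set X) (w : W) :
    \bar R :=
  ereal_inf [set (n%:R : R)%:E | n in [set n : nat | A (Phi n w)]].

Definition tau_hit (Phi : nat -> {mfun W >-> X}) (A : set X) (w : W) :
    \bar R :=
  ereal_inf
    [set (n%:R : R)%:E | n in [set n : nat | (1 <= n)%N /\ A (Phi n w)]].

Definition first_return (Pr : X -> probability W R)
    (Phi : nat -> {mfun W >-> X}) (n : nat) (x : X) (A : set X) : \bar R :=
  Pr x [set w | tau_hit Phi A w = (n%:R : R)%:E].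

End MarkovChain.

Section Kernels.
Context (R : realType) (d : measure_display) (X : measurableType d).

Definition invariant_measure (P : R.-pker X ~> X) (pi : probability X R) : Prop :=
  forall B : set X, measurable B -> (\int[pi]_x P x B)%E = pi B.

(* pi(dx)P(x,dy) = pi(dy)P(y,dx), evaluated on measurable rectangles. *)
Definition reversible (P : R.-pker X ~> X) (pi : probability X R) : Prop :=
  forall B C : set X, measurable B -> measurable C ->
    (\int[pi]_(x in B) P x C)%E = (\int[pi]_(y in C) P y B)%E.

(* The norm of the signed measure mu1 - mu2: the supremum of |mu1(f) - mu2(f)|
   over |f| <= 1, hence twice the supremum over sets of |mu1(B) - mu2(B)|. *)
Definition var_dist (mu1 mu2 : probability X R) : \bar R :=
  ereal_sup
    [set (`| \int[mu1]_x f x - \int[mu2]_x f x |)%:E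
       | f in [set f : X -> R |
                 measurable_fun [set: X] f /\ forall x, `|f x| <= 1]].

Definition unif_var_dist (Q : X -> probability X R) (pi : probability X R) :
    \bar R :=
  ereal_sup (range (fun x : X => var_dist (Q x) pi)).

End Kernels.

(* Main.v *)
(** Regenerate the chain in two ways.  Write [R = P - delta 1_A (x) nu] and
    [S = P^2 - a 1_A (x) nu] with [a = delta^2 nu(A)]; both are positive.  The
    functions [E_x[lambda^sigma_A]], bounded by [h = 1 / (1 - M log lambda)],
    and its splitting according to the parity of [sigma_A] are Lyapunov
    functions giving [R^n 1 <= M_3 lambda^(-n-1)] and [S^n 1 <= C lambda^(-2n)];
    the condition on even return times is needed for [S] only.

    Let [g = dnu/dpi <= 1 / (a pi(A))] and [v_n = |P^n (g - 1)|^2] in L^2(pi).  By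
    reversibility [v_n = nu (P^(2n) (g - 1))] satisfies the renewal equation
    [sum_(k <= n) nu(S^k 1) v_(n-k) = - pi(S^(n+1) (g - 1)) / (a pi(A))].  All
    terms on the left are nonnegative, so already the term [k = 0] gives
    [v_n = O(lambda^(-2n))], and [v_n^2 <= v_0 v_(2n)] improves this to
    [v_n <= v_0 lambda^(-2n) <= C_3^2 lambda^(-2n)]: a chain started from [nu]
    converges at rate [C_3 lambda^(-n)].

    Finally decompose [P^n] at the first regeneration time [T] of [R]; summation
    by parts against [P_x(T > n) = R^n 1 <= M_3 lambda^(-n-1)] yields the bound. *)

Require Import Defs.
From HB Require Import structures.
From mathcomp Require Import all_boot all_order all_algebra.
From mathcomp Require Import all_classical all_reals all_analysis.
From mathcomp Require Import measurable_realfun ring lra.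

Set Implicit Arguments.
Unset Strict Implicit.
Unset Printing Implicit Defensive.

Import Order.TTheory GRing.Theory Num.Theory.
Import numFieldNormedType.Exports.

Local Open Scope classical_set_scope.
Local Open Scope ring_scope.

(** * Operators on bounded measurable functions *)

Section BoundedMeasurable.
Context (R : realType) (d : measure_display) (X : measurableType d).

Definition bounded_measurable : {pred X -> R} :=
  fun f => `[< measurable_fun [set: X] f /\ exists C, forall x, `|f x| <= C >].

Lemma bounded_measurableP (f : X -> R) :
  reflect (measurable_fun [set: X] f /\ exists C, forall x, `|f x| <= C)
    (f \in bounded_measurable).
Proof. exact: asboolP. Qed.

Fact bounded_measurable_subring : subring_closed bounded_measurable.
Proof.
split=> [|f g /asboolP[mf [C hC]] /asboolP[mg [D hD]]|
         f g /asboolP[mf [C hC]] /asboolP[mg [D hD]]]; apply/asboolP.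
- split; first exact: measurable_cst.
  by exists 1 => x; rewrite normr1.
- split; first exact: measurable_funB.
  by exists (C + D) => x; rewrite (le_trans (ler_normB _ _))// lerD.
- split; first exact: measurable_funM.
  by exists (C * D) => x; rewrite normrM ler_pM.
Qed.

Fact bounded_measurable_scale : GRing.scaler_closed bounded_measurable.
Proof.
move=> a f /asboolP[mf [C hC]]; apply/asboolP; split.
  exact: measurable_funM.
by exists (`|a| * C) => x; rewrite normrM ler_wpM2l.
Qed.

HB.instance Definition _ := GRing.isSubringClosed.Build (X -> R)
  bounded_measurable bounded_measurable_subring.
HB.instance Definition _ := GRing.isScaleClosed.Build R (X -> R)
  bounded_measurable bounded_measurable_scale.

(** The common domain of all operators below. Probability integrals of such functions are finite and
    products stay inside, so kernels become linear maps, measures become linear forms, and the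
    probabilistic argument becomes algebra with positivity. *)
Record bmfun := BMFun {
  bm_val :> X -> R ; bm_valP : bm_val \in bounded_measurable }.
HB.instance Definition _ := [isSub for bm_val].
HB.instance Definition _ := [Choice of bmfun by <:].
HB.instance Definition _ := [SubChoice_isSubComNzRing of bmfun by <:].
HB.instance Definition _ := [SubZmodule_isSubLmodule of bmfun by <:].

Lemma bmfunP (f g : bmfun) : (forall x, f x = g x) <-> f = g.
Proof. by split=> [e|->//]; apply/val_inj/funext. Qed.

Lemma bm_1E (x : X) : (1 : bmfun) x = 1. Proof. by []. Qed.
Lemma bm_0E (x : X) : (0 : bmfun) x = 0. Proof. by []. Qed.
Lemma bm_addE (f g : bmfun) (x : X) : (f + g) x = f x + g x. Proof. by []. Qed.
Lemma bm_oppE (f : bmfun) (x : X) : (- f) x = - f x. Proof. by []. Qed.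
Lemma bm_mulE (f g : bmfun) (x : X) : (f * g) x = f x * g x. Proof. by []. Qed.
Lemma bm_scaleE a (f : bmfun) (x : X) : (a *: f) x = a * f x. Proof. by []. Qed.
Lemma bm_sumE (I : Type) (r : seq I) (p : pred I) (F : I -> bmfun) (x : X) :
  (\sum_(i <- r | p i) F i) x = \sum_(i <- r | p i) F i x.
Proof. by apply: (big_ind2 (fun (f : bmfun) y => f x = y)) => // ? ? ? ? <- <-. Qed.
Definition bmE := (bm_1E, bm_0E, bm_addE, bm_oppE, bm_mulE, bm_scaleE).

End BoundedMeasurable.
Arguments bm_val : simpl never.

Definition bm_le (R : realType) (d : measure_display) (X : measurableType d)
  (f g : bmfun R X) : Prop := forall x, f x <= g x.

Notation "f <=1 g" := (bm_le f g) (at level 70, no associativity) : ring_scope.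

Section Operators.
Context (R : realType) (d : measure_display) (X : measurableType d).
Implicit Types (f g : bmfun R X).

Definition opow (L : bmfun R X -> bmfun R X) (n : nat) f := iter n L f.

Lemma opow0 L f : opow L 0 f = f. Proof. by []. Qed.
Lemma opowS L n f : opow L n.+1 f = L (opow L n f). Proof. by []. Qed.
Lemma opowSr L n f : opow L n.+1 f = opow L n (L f). Proof. exact: iterSr. Qed.
Lemma opowD L m n f : opow L (m + n) f = opow L m (opow L n f).
Proof. exact: iterD. Qed.

Fact opow_linear (L : {linear bmfun R X -> bmfun R X}) n : linear (opow L n).
Proof. by elim: n => [|n ih] a f g //; rewrite !opowS ih linearP. Qed.
HB.instance Definition _ (L : {linear bmfun R X -> bmfun R X}) n :=
  GRing.isLinear.Build R (bmfun R X) (bmfun R X) _ (opow L n) (opow_linear L n).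

Definition positive_op (L : bmfun R X -> bmfun R X) : Prop :=
  forall f, 0 <=1 f -> 0 <=1 L f.

Lemma bm_subr_ge0 f g : 0 <=1 g - f <-> f <=1 g.
Proof. by split=> fg x; move: (fg x); rewrite !bmE subr_ge0. Qed.

Lemma op_le (L : {linear bmfun R X -> bmfun R X}) f g :
  positive_op L -> f <=1 g -> L f <=1 L g.
Proof. by move=> pL /bm_subr_ge0 fg; apply/bm_subr_ge0; rewrite -linearB; apply: pL. Qed.

Lemma opow_positive (L : bmfun R X -> bmfun R X) n :
  positive_op L -> positive_op (opow L n).
Proof. by move=> pL; elim: n => [|n ih] f f0 //; apply/pL/ih. Qed.

Lemma functional_le (l : {scalar bmfun R X}) f g :
  (forall f, 0 <=1 f -> 0 <= l f) -> f <=1 g -> l f <= l g.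
Proof. by move=> pl /bm_subr_ge0 fg; rewrite -subr_ge0 -linearB; apply: pl. Qed.

(** Positivity carries [- K <= f <= K] through every iterate. *)
Lemma opow_norm_le (L : {linear bmfun R X -> bmfun R X}) n f K x :
  positive_op L -> (forall x, `|f x| <= K) ->
  `|opow L n f x| <= K * opow L n 1 x.
Proof.
move=> pL fK; rewrite ler_norml.
have pLn := opow_positive n pL.
have h (g : bmfun R X) : (forall x, g x <= K) -> opow L n g x <= K * opow L n 1 x.
  move=> gK; have /(op_le pLn)/(_ x) : g <=1 K *: (1 : bmfun R X) by move=> y; rewrite !bmE mulr1.
  by rewrite linearZ.
apply/andP; split.
  rewrite lerNl -bm_oppE -linearN; apply: h => y.
  by rewrite bmE lerNl; move: (fK y); rewrite ler_norml => /andP[].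
by apply: h => y; move: (fK y); rewrite ler_norml => /andP[].
Qed.

End Operators.

(** * Splitting a Markov operator at its regenerations *)

Section Regeneration.
Context (R : realType) (d : measure_display) (X : measurableType d).
Variables (Q : {linear bmfun R X -> bmfun R X}) (nu : {scalar bmfun R X}).
Variables (iA : bmfun R X) (a : R).
Hypotheses (Q1 : Q 1 = 1) (nu1 : nu 1 = 1).
Hypothesis minorization : forall f, 0 <=1 f -> (a * nu f) *: iA <=1 Q f.

(* [locked] keeps rewriting with [bm_addE] from unfolding the sum. *)
Definition residual (f : bmfun R X) : bmfun R X :=
  locked (Q f - (a * nu f) *: iA).

Lemma residualK f : Q f = residual f + (a * nu f) *: iA.
Proof. by rewrite /residual -lock subrK. Qed.

Lemma residualE f x : residual f x = Q f x - a * nu f * iA x.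
Proof. by rewrite residualK bm_addE bm_scaleE addrK. Qed.

Fact residual_linear : linear residual.
Proof.
move=> c f g; apply/bmfunP => x.
by rewrite bm_addE bm_scaleE !residualE !linearP bm_addE bm_scaleE; ring.
Qed.
HB.instance Definition _ :=
  GRing.isLinear.Build R (bmfun R X) (bmfun R X) _ residual residual_linear.

Lemma residual_positive : positive_op residual.
Proof.
by move=> f f0 x; rewrite residualE subr_ge0 -bm_scaleE; apply: minorization.
Qed.

(** [a *: iA] is exactly the mass that [residual] removes from 1. The difference of survival
    probabilities is the probability of a first regeneration at step [k.+1]. *)
Lemma residual_pow_iA k :
  a *: opow residual k iA = opow residual k 1 - opow residual k.+1 1.
Proof.
rewrite opowSr -linearB -linearZ; congr (opow _ _ _).
by rewrite -[X in X - _]Q1 residualK nu1 mulr1 addrC addKr.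
Qed.

(** Either no regeneration occurs within [n] steps, or the first one occurs at step [k.+1] and the
    chain restarts from [nu] with [n - k.+1] steps left. *)
Lemma first_regeneration n f : opow Q n f = opow residual n f +
  \sum_(k < n) nu (opow Q (n - k.+1) f) *: (a *: opow residual k iA).
Proof.
elim: n => [|n ih]; first by rewrite big_ord0 addr0.
rewrite opowS residualK big_ord_recl /= subn1 /=.
rewrite [nu _ *: _]scalerA [nu _ * _]mulrC.
rewrite [RHS]addrCA [RHS]addrC; congr (_ + _).
rewrite {1}ih linearD linear_sum; congr (_ + _).
by apply: eq_bigr => k _; rewrite /bump /= add1n subSS linearZ /= linearZ.
Qed.

(* [nu (residual^k 1)] is the probability under nu that no regeneration
   has occurred by time k. *)
Lemma renewal_identity n f :
  \sum_(k < n.+1) nu (opow residual k 1) * nu (opow Q (n - k) f) =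
  \sum_(j < n.+1) nu (opow residual j f).
Proof.
elim: n => [|n ih]; first by rewrite !big_ord_recl !big_ord0 /= nu1 mul1r.
rewrite [RHS]big_ord_recr -ih /= big_ord_recl /= nu1 mul1r ?subn0.
(* Only the term [k = 0] is expanded. Its weights are differences of consecutive survival
   probabilities; their subtracted parts cancel the other terms and leave the sum for [n]. *)
rewrite -opowS first_regeneration linearD linear_sum /=.
rewrite -addrA [RHS]addrC; congr (_ + _).
rewrite -big_split /=; apply: eq_bigr => k _.
rewrite linearZ /= residual_pow_iA linearB /= /bump /= add1n !subSS.
by rewrite mulrC -mulrDl subrK.
Qed.

(* Telescoping of [pi = pi residual + a pi(A) nu]. *)
Lemma stationary_regeneration (pi : {scalar bmfun R X}) n f :
  (forall f, pi (Q f) = pi f) ->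
  a * pi iA * \sum_(j < n) nu (opow residual j f) =
    pi f - pi (opow residual n f).
Proof.
move=> piQ; elim: n => [|n ih]; first by rewrite big_ord0 mulr0 subrr.
rewrite big_ord_recr mulrDr ih /= -[pi (opow _ n f)]piQ residualK.
rewrite linearD linearZ /=; ring.
Qed.

End Regeneration.
Arguments opow : simpl never.

(** * Geometric moments of the hitting time *)

Section Hitting.
Context (R : realType) (d : measure_display) (X : measurableType d).
Variables (P : {linear bmfun R X -> bmfun R X}) (iA : bmfun R X).
Hypotheses (Ppos : positive_op P) (P1 : P 1 = 1).
Hypothesis iA01 : forall x, iA x = 0 \/ iA x = 1.

(** The chain killed on A: [opow taboo k f] at x is E_x[f(Phi_k); sigma_A >= k]. In particular the
    sums bounded by [M] in [hM] are E_x[min(sigma_A, N)]. *)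
Definition taboo (f : bmfun R X) : bmfun R X := locked ((1 - iA) * P f).

Lemma tabooE f x : taboo f x = (1 - iA x) * P f x.
Proof. by rewrite /taboo -lock. Qed.

Fact taboo_linear : linear taboo.
Proof.
move=> c f g; apply/bmfunP => x.
by rewrite bm_addE bm_scaleE !tabooE linearP bm_addE bm_scaleE; ring.
Qed.
HB.instance Definition _ :=
  GRing.isLinear.Build R (bmfun R X) (bmfun R X) _ taboo taboo_linear.

Lemma taboo_positive : positive_op taboo.
Proof.
move=> f f0 x; rewrite tabooE; apply: mulr_ge0; last exact: Ppos.
by case: (iA01 x) => ->; rewrite ?subr0 ?subrr ?ler01.
Qed.

Lemma taboo_off f x : iA x = 0 -> taboo f x = P f x.
Proof. by move=> h; rewrite tabooE h subr0 mul1r. Qed.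

Lemma taboo_on f x : iA x = 1 -> taboo f x = 0.
Proof. by move=> h; rewrite tabooE h subrr mul0r. Qed.

Lemma taboo1 : taboo 1 = 1 - iA. Proof. by rewrite /taboo -lock P1 mulr1. Qed.

(* E_x[lambda^(min(sigma_A, N))] *)
Fixpoint hit_gen (lam : R) (N : nat) : bmfun R X :=
  if N is N'.+1 then iA + lam *: taboo (hit_gen lam N') else 1.

Lemma hit_genS lam N : hit_gen lam N.+1 = iA + lam *: taboo (hit_gen lam N).
Proof. by []. Qed.

Variables (lam M : R).
Hypothesis lam1 : 1 < lam.
Hypothesis hM : forall N x, \sum_(k < N) opow taboo k.+1 1 x <= M.

Let lam0 : 0 < lam. Proof. exact: lt_trans lam1. Qed.

Lemma hit_gen_off N x : iA x = 0 -> hit_gen lam N.+1 x = lam * P (hit_gen lam N) x.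
Proof. by move=> h; rewrite hit_genS bm_addE bm_scaleE taboo_off// h add0r. Qed.

Lemma hit_gen_on N x : iA x = 1 -> hit_gen lam N x = 1.
Proof. by case: N => [//|N] h; rewrite hit_genS bm_addE bm_scaleE taboo_on// h mulr0 addr0. Qed.

Lemma hit_gen_ge1 N : 1 <=1 hit_gen lam N.
Proof.
elim: N => [//|N ih] x; case: (iA01 x) => h; last by rewrite hit_gen_on.
rewrite hit_gen_off// -[leLHS]mul1r; apply: ler_pM => //.
- exact: ltW.
- by have := op_le Ppos ih x; rewrite P1.
Qed.

Lemma hit_gen_nondecreasing : {homo hit_gen lam : m n / (m <= n)%N >-> bm_le m n}.
Proof.
apply: homo_leq.
- by move=> f x.
- by move=> g f h fg gh x; apply: le_trans (gh x).
- elim=> [|n ih]; first exact: hit_gen_ge1.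
  move=> x; case: (iA01 x) => h; last by rewrite !hit_gen_on.
  by rewrite !hit_gen_off// ler_pM2l//; apply: op_le.
Qed.

Lemma survival_ge0 n : 0 <=1 opow taboo n 1.
Proof. by apply: opow_positive; [exact: taboo_positive|move=> x; rewrite ler01]. Qed.

(* With H a bound on E_x[lambda^(min(sigma_A, N))], writing
   lambda^sigma = 1 + (1 - 1/lambda) sum_(k < sigma) lambda^(sigma - k)
   and applying the Markov property at time k bounds it by 1 + (1 - 1/lambda) H M. *)
Lemma hit_gen_step N (H : R) n : (forall x, hit_gen lam N x <= H) -> (n <= N)%N ->
  forall x, hit_gen lam n x <=
    1 + (1 - lam^-1) * H * \sum_(k < n) opow taboo k.+1 1 x.
Proof.
move=> hH; have lam'_ge0 : 0 <= 1 - lam^-1.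
  by rewrite subr_ge0 invf_le1// ltW.
have H0 : 0 <= H by apply: le_trans (hH point); apply: le_trans (hit_gen_ge1 _ _).
elim: n => [_ x|n ih nN x]; first by rewrite big_ord0 mulr0 addr0.
case: (iA01 x) => h; last first.
  rewrite hit_gen_on// lerDl; apply: mulr_ge0; first exact: mulr_ge0.
  by apply: sumr_ge0 => k _; apply: survival_ge0.
(* The factor [lam] is split as 1 + (lam - 1). The first part is treated by induction, the second by
   the bound [H]. *)
have -> : hit_gen lam n.+1 x =
    P (hit_gen lam n) x + (1 - lam^-1) * hit_gen lam n.+1 x.
  by rewrite hit_gen_off// mulrBl mul1r mulKf ?gt_eqF//; ring.
have le1 : P (hit_gen lam n) x <=
    1 + (1 - lam^-1) * H * \sum_(k < n) P (opow taboo k.+1 1) x.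
  have /(op_le Ppos)/(_ x) : hit_gen lam n <=1
      1 + ((1 - lam^-1) * H) *: \sum_(k < n) opow taboo k.+1 1.
    by move=> y; rewrite !bmE bm_sumE; apply: ih; rewrite ltnW.
  by rewrite linearD P1 linearZ linear_sum bm_addE bm_scaleE bm_sumE.
have le2 : (1 - lam^-1) * hit_gen lam n.+1 x <= (1 - lam^-1) * H.
  by apply: ler_wpM2l => //; apply: le_trans (hH x); apply: hit_gen_nondecreasing.
apply: le_trans (lerD le1 le2) _.
(* Off A the first step is survived for certain, so the single term [(1 - lam^-1) * H] is the
   summand [k = 0] of the shifted sum. *)
have e1 : opow taboo 1 1 x = 1 by rewrite opowS /opow taboo1 bm_addE bm_oppE bm_1E h subr0.
rewrite big_ord_recl /= e1 -addrA lerD2l mulrDr mulr1 addrC lerD2l.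
rewrite le_eqVlt; apply/orP; left; apply/eqP; congr (_ * _).
by apply: eq_bigr => k _; rewrite /bump /= add1n !opowS taboo_off.
Qed.

(** With H the supremum of [hit_gen lam N], finite thanks to the truncation, the previous bound
    reads H <= 1 + (1 - 1/lam) M H. Since 1 - 1/lam <= log lam, this can be solved for H, uniformly
    in [N]. *)
Lemma hit_gen_le N x : M * ln lam < 1 -> hit_gen lam N x <= (1 - M * ln lam)^-1.
Proof.
move=> Mlam; have M0 : 0 <= M by have := hM 0 x; rewrite big_ord0.
pose H := sup (range (hit_gen lam N)).
have hs : has_sup (range (hit_gen lam N)).
  split; first by exists (hit_gen lam N point); exists point.
  have /bounded_measurableP[_ [C hC]] := bm_valP (hit_gen lam N).
  by exists C => _ [y _ <-]; apply: le_trans (ler_norm _) (hC y).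
have hH y : hit_gen lam N y <= H by apply: sup_upper_bound => //; exists y.
have H0 : 0 <= H by apply: le_trans (hH point); apply: le_trans (hit_gen_ge1 _ _).
have lam'_ge0 : 0 <= 1 - lam^-1.
  by rewrite subr_ge0 invf_le1// ltW.
have HM : H <= 1 + (1 - lam^-1) * H * M.
  apply: ge_sup; first by case: hs.
  move=> _ [y _ <-]; apply: le_trans (hit_gen_step hH (leqnn N) y) _.
  by rewrite lerD2l; apply: ler_wpM2l => //; apply: mulr_ge0.
have lnlam : 1 - lam^-1 <= ln lam.
  have lamV : -1 < lam^-1 - 1 by rewrite ltrBrDr addrC subrr invr_gt0.
  have := le_ln1Dx lamV; rewrite [1 + _]addrC subrK lnV ?posrE//; lra.
apply: le_trans (hH x) _.
rewrite -[leRHS]mul1r ler_pdivlMr ?subr_gt0//.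
have : (1 - lam^-1) * (H * M) <= ln lam * (H * M) by rewrite ler_wpM2r ?mulr_ge0.
by move: HM; nra.
Qed.

End Hitting.

(** * Tail of the regeneration time for one step of the chain *)

Section OneStepRegeneration.
Context (R : realType) (d : measure_display) (X : measurableType d).
Variables (P : {linear bmfun R X -> bmfun R X}) (iA : bmfun R X).
Variables (nu : {scalar bmfun R X}) (delta lam M : R).
Hypotheses (Ppos : positive_op P) (P1 : P 1 = 1).
Hypothesis iA01 : forall x, iA x = 0 \/ iA x = 1.
Hypotheses (nupos : forall f, 0 <=1 f -> 0 <= nu f) (nu1 : nu 1 = 1).
Hypotheses (delta0 : 0 < delta) (lam1 : 1 < lam).
Hypothesis minorization : forall f, 0 <=1 f -> (delta * nu f) *: iA <=1 P f.
Hypothesis hM : forall N x, \sum_(k < N) opow (taboo P iA) k.+1 1 x <= M.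
Hypothesis Mlam : M * ln lam < 1.

Local Notation h := (1 - M * ln lam)^-1.
Local Notation res := (residual P nu iA delta).
Hypothesis geometric : 0 < 1 + delta * lam - lam * h.
Local Notation m := (delta * lam / (1 + delta * lam - lam * h)).

Let lam0 : 0 < lam. Proof. exact: lt_trans lam1. Qed.

Let h1 : 1 <= h.
Proof.
apply: le_trans (hit_gen_le Ppos P1 iA01 lam1 hM 0 point Mlam).
by rewrite /= lexx.
Qed.

(** Drift inequality. Off A it is the recursion of [hit_gen]. On A, P maps [hit_gen] below h while
    [nu] gives it mass at least 1, and [m] is the solution of lam m (h - delta) + delta lam = m. *)
Let res_step N :
  lam *: res (m *: hit_gen P iA lam N) + (delta * lam) *: iA
    <=1 m *: hit_gen P iA lam N.+1.
Proof.
have m0 : 0 < m by rewrite divr_gt0// mulr_gt0.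
have mE : m * (1 + delta * lam - lam * h) = delta * lam by rewrite divfK// gt_eqF.
move=> x; rewrite linearZ bm_addE !bm_scaleE !residualE.
case: (iA01 x) => hx.
  by rewrite hit_gen_off// hx !mulr0 subr0 addr0 mulrCA.
rewrite hit_gen_on// hx !mulr1.
have w1 : 1 <= nu (hit_gen P iA lam N).
  by rewrite -nu1; apply: functional_le => //; apply: hit_gen_ge1.
have w2 : P (hit_gen P iA lam N) x <= h.
  have : hit_gen P iA lam N <=1 h *: (1 : bmfun R X).
    move=> y; rewrite !bmE mulr1; exact: (hit_gen_le Ppos P1 iA01 lam1 hM N y Mlam).
  by move=> /(op_le Ppos)/(_ x); rewrite linearZ P1 bm_scaleE bm_1E mulr1.
have dw : delta <= delta * nu (hit_gen P iA lam N) by rewrite ler_peMr// ltW.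
have : P (hit_gen P iA lam N) x - delta * nu (hit_gen P iA lam N) <= h - delta.
  by rewrite lerB.
rewrite -(ler_pM2l (mulr_gt0 lam0 m0)); lra.
Qed.

Lemma one_step_tail n x : lam ^+ n.+1 * opow res n 1 x <= m * h.
Proof.
suff H : lam ^+ n.+1 *: opow res n 1 <=1 m *: hit_gen P iA lam n.+1.
  have := H x; rewrite !bm_scaleE => /le_trans; apply.
  apply: ler_wpM2l; last exact: (hit_gen_le Ppos P1 iA01 lam1 hM _ _ Mlam).
  by rewrite ltW// divr_gt0// mulr_gt0.
have m1 : 1 <= m.
  rewrite ler_pdivlMr// mul1r.
  by have := mulr_ege1 (ltW lam1) h1; lra.
have dpos y : 0 <= (delta * lam) * iA y.
  by apply: mulr_ge0; [rewrite ltW// mulr_gt0|case: (iA01 y) => ->].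
have rpos : positive_op res by exact: residual_positive.
elim: n => [|n ih] y.
  (* The surplus [(delta * lam) *: iA] of the drift restores the mass that [res] takes from 1, so
     the induction starts with a full power [lam] at [n = 0]. *)
  apply: le_trans (res_step 0 y).
  have : (1 : bmfun R X) <=1 m *: (1 : bmfun R X) by move=> z; rewrite !bmE mulr1.
  move=> /(op_le rpos)/(_ y); rewrite -(ler_pM2l lam0) /=.
  rewrite bm_addE !bm_scaleE => /(lerD (lexx (delta * lam * iA y))).
  rewrite [leRHS]addrC; apply: le_trans.
  rewrite opow0 expr1 residualE P1 nu1 bm_1E; lra.
apply: le_trans (res_step n.+1 y).
have := op_le rpos ih y; rewrite linearZ bm_scaleE -(ler_pM2l lam0) => h'.
rewrite bm_addE !bm_scaleE opowS exprS -[lam * _ * _]mulrA.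
by apply: le_trans h' _; rewrite lerDl.
Qed.

End OneStepRegeneration.

(** * Tail of the regeneration time for two steps, with parity of the hitting time *)

Section TwoStepRegeneration.
Context (R : realType) (d : measure_display) (X : measurableType d).
Variables (P : {linear bmfun R X -> bmfun R X}) (iA : bmfun R X).
Variables (nu : {scalar bmfun R X}) (delta lam theta M : R).
Hypotheses (Ppos : positive_op P) (P1 : P 1 = 1).
Hypothesis iA01 : forall x, iA x = 0 \/ iA x = 1.

(* The partial sum of E_x[lambda^sigma_A; sigma_A < N] over the values of sigma_A
   of parity b. *)
Fixpoint hit_par (b : bool) (N : nat) : bmfun R X :=
  if N is N'.+1 then
    (if b then 0 else iA) + lam *: taboo P iA (hit_par (~~ b) N')
  else 0.

Lemma hit_parS b N : hit_par b N.+1 =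
  (if b then 0 else iA) + lam *: taboo P iA (hit_par (~~ b) N).
Proof. by []. Qed.

Lemma hit_parE b N : hit_par b N =
  \sum_(k < N | odd k == b) lam ^+ k *: opow (taboo P iA) k iA.
Proof.
elim: N b => [|N ih] b; first by rewrite big_ord0.
rewrite [RHS]big_mkcond big_ord_recl hit_parS ih linear_sum scaler_sumr.
rewrite [X in _ + X = _]big_mkcond; congr (_ + _).
  by case: b; rewrite ?expr0 ?scale1r.
apply: eq_bigr => k _; rewrite lift0.
have -> : (odd k.+1 == b) = (odd k == ~~ b) by case: b => /=; case: odd.
by case: ifP => // _; rewrite linearZ scalerA -exprS.
Qed.

Hypotheses (nupos : forall f, 0 <=1 f -> 0 <= nu f) (nu1 : nu 1 = 1).
Hypotheses (delta0 : 0 < delta) (lam1 : 1 < lam).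
Hypothesis minorization : forall f, 0 <=1 f -> (delta * nu f) *: iA <=1 P f.
Hypothesis hM : forall N x, \sum_(k < N) opow (taboo P iA) k.+1 1 x <= M.
Hypothesis Mlam : M * ln lam < 1.
Hypotheses (theta0 : 0 <= theta) (theta1 : theta < 1).
Hypothesis htheta : forall N x, iA x = 1 -> lam * P (hit_par true N) x <= theta.

Local Notation h := (1 - M * ln lam)^-1.
Local Notation a := (delta ^+ 2 * nu iA).
Local Notation res := (residual (opow P 2) nu iA a).
Local Notation u := (lam * h / (1 - theta)).
Hypothesis geometric : u * (lam * h) < 1 + a * lam ^+ 2.

Let lam0 : 0 < lam. Proof. exact: lt_trans lam1. Qed.

Let h1 : 1 <= h.
Proof.
apply: le_trans (hit_gen_le Ppos P1 iA01 lam1 hM 0 point Mlam).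
by rewrite /= lexx.
Qed.

Let u1 : 1 <= u.
Proof.
rewrite ler_pdivlMr ?subr_gt0// mul1r.
apply: le_trans (mulr_ege1 (ltW lam1) h1); by rewrite lerBlDr lerDl.
Qed.

(** The minorization is used twice, for [f] and then for [iA] itself: a path from A to A and then on
    to [nu]. *)
Lemma minorization2 f : 0 <=1 f -> (a * nu f) *: iA <=1 opow P 2 f.
Proof.
move=> f0; have h' := op_le Ppos (minorization f0).
move=> x; apply: le_trans (h' x); rewrite linearZ bm_scaleE.
have iApos : 0 <=1 iA by move=> y; case: (iA01 y) => ->.
have := minorization iApos x; rewrite !bm_scaleE.
have w : 0 <= delta * nu f by rewrite mulr_ge0 ?nupos// ltW.
by move=> /(ler_wpM2l w); apply: le_trans; rewrite le_eqVlt; apply/orP; left; apply/eqP; ring.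
Qed.

Lemma hit_par_ge0 b N : 0 <=1 hit_par b N.
Proof.
elim: N b => [|N ih] b x; first by [].
rewrite hit_parS bm_addE bm_scaleE; apply: addr_ge0.
  by case: b => //; case: (iA01 x) => ->.
by apply: mulr_ge0; [exact: ltW | apply: taboo_positive].
Qed.

Lemma hit_par_le_gen N : hit_par false N + hit_par true N <=1 hit_gen P iA lam N.
Proof.
elim: N => [|N ih] x; first by rewrite /= bm_addE addr0 ler01.
rewrite !hit_parS hit_genS add0r -addrA -scalerDr -linearD addrC /=.
rewrite ![bm_val (_ + iA) x]bm_addE [leRHS]bm_addE [leRHS]addrC lerD2r !bm_scaleE ler_pM2l//.
by apply: op_le; [exact: taboo_positive|rewrite addrC].
Qed.

(** The left side is P_x(sigma_A < N), and the weights lam^sigma_A are at least 1. *)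
Lemma hit_par_lower N :
  1 - opow (taboo P iA) N 1 <=1 hit_par false N + hit_par true N.
Proof.
elim: N => [|N ih] x; first by rewrite opow0 subrr /= addr0 lexx.
rewrite !hit_parS add0r -addrA -scalerDr -linearD addrC.
have := op_le (taboo_positive Ppos iA01) ih x.
rewrite linearB /= opowS taboo1// !bm_addE !bm_oppE bm_1E bm_scaleE.
rewrite [hit_par false N + _]addrC => h'.
have : 0 <= taboo P iA (hit_par true N + hit_par false N) x.
  by apply: taboo_positive => // y; rewrite bm_addE addr_ge0// hit_par_ge0.
move: h' lam1; nra.
Qed.

(** Markov's inequality: survival probabilities decrease in time, so [N] copies of the last one are
    below their sum. *)
Lemma survival_le N x : N%:R * opow (taboo P iA) N 1 x <= M.
Proof.
apply: le_trans (hM N x).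
have dec n : opow (taboo P iA) n.+1 1 <=1 opow (taboo P iA) n 1.
  rewrite opowSr taboo1//; apply: op_le; first by apply/opow_positive/taboo_positive.
  by move=> y; rewrite bm_addE bm_oppE gerDl oppr_le0; case: (iA01 y) => ->.
have dec' m n : (m <= n)%N -> opow (taboo P iA) n 1 x <= opow (taboo P iA) m 1 x.
  move/subnK <-; elim: (n - m)%N => [//|k ihk].
  by rewrite addSn; apply: le_trans (dec _ x) ihk.
rewrite mulrC mulr_natr -[N in _ *+ N]card_ord -sumr_const.
by apply: ler_sum => k _; apply: dec'.
Qed.

(** Lyapunov functions that charge one parity of sigma_A with the extra weight [u]; off A, one step
    of P exchanges the parities. The value of [u] solves u (1 - theta) = lam h. In [htheta], an odd
    hitting time after one step is an even return time. *)
Let B0 N := hit_par false N + u *: hit_par true N.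
Let B1 N := hit_par true N + u *: hit_par false N.

Let P_hit_par_le N x :
  lam * P (hit_par false N) x + lam * P (hit_par true N) x <= lam * h.
Proof.
rewrite -mulrDr ler_pM2l// -bm_addE -linearD.
have : hit_par false N + hit_par true N <=1 h *: (1 : bmfun R X).
  move=> y; apply: le_trans (hit_par_le_gen N y) _.
  rewrite bm_scaleE bm_1E mulr1.
  exact: (hit_gen_le Ppos P1 iA01 lam1 hM N y Mlam).
by move=> /(op_le Ppos)/(_ x); rewrite linearZ P1 bm_scaleE bm_1E mulr1.
Qed.

Let P_hit_par_ge0 b N x : 0 <= lam * P (hit_par b N) x.
Proof. by rewrite mulr_ge0 ?(ltW lam0)//; apply/Ppos/hit_par_ge0. Qed.

Let uE : u * (1 - theta) = lam * h.
Proof. by rewrite divfK// subr_eq0 gt_eqF. Qed.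

(** Off A this is the parity exchange. On A the even and odd parts s, t satisfy s + t <= lam h and t
    <= theta, whence s + u t <= u, the value of [B1] there. *)
Let stepB0 N : lam *: P (B0 N) <=1 B1 N.+1.
Proof.
move=> x; rewrite /B0 /B1 !hit_parS linearD linearZ add0r.
rewrite bm_scaleE !bm_addE !bm_scaleE bm_addE bm_scaleE.
case: (iA01 x) => hx.
  rewrite hx !(taboo_off _ _ hx) add0r le_eqVlt; apply/orP; left; apply/eqP.
  ring.
rewrite hx !(taboo_on _ _ hx) !mulr0 addr0 add0r mulr1.
have := P_hit_par_le N x; have := htheta N hx; have := P_hit_par_ge0 true N x.
move: uE u1.
set t := lam * P (hit_par true N) x; set s := lam * P (hit_par false N) x.
rewrite (_ : lam * (_ + _) = s + u * t); last by rewrite /s /t; ring.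
set v := u; set l := lam * h; nra.
Qed.

Let stepB1_off N x : iA x = 0 -> lam * P (B1 N) x = B0 N.+1 x.
Proof.
move=> hx; rewrite /B0 /B1 !hit_parS linearD linearZ add0r.
rewrite !bm_addE !bm_scaleE hx !(taboo_off _ _ hx); ring.
Qed.

Let stepB1_on N x : lam * P (B1 N) x <= u * (lam * h).
Proof.
rewrite /B1 linearD linearZ bm_addE bm_scaleE.
have := P_hit_par_le N x; have := P_hit_par_ge0 true N x; have := P_hit_par_ge0 false N x.
move: u1.
set t := lam * P (hit_par true N) x; set s := lam * P (hit_par false N) x.
rewrite (_ : lam * (_ + _) = t + u * s); last by rewrite /s /t; ring.
set v := u; set l := lam * h; nra.
Qed.

Let iApos : 0 <=1 iA. Proof. by move=> y; case: (iA01 y) => ->. Qed.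

Let a0 : 0 <= a. Proof. by apply: mulr_ge0; [exact: sqr_ge0|exact: nupos]. Qed.

Let B0_lower N : 1 - opow (taboo P iA) N 1 <=1 B0 N.
Proof.
move=> x; apply: le_trans (hit_par_lower N x) _.
rewrite /B0 !bm_addE bm_scaleE lerD2l ler_peMl//; exact: hit_par_ge0.
Qed.

(** On A, two steps give at most u lam h, and regeneration removes a lam^2 nu(B0 N). Truncation at
    [N] costs [nu] a mass of at most M/N, which the strict inequality [geometric] absorbs once [N]
    is large. *)
Let res_B0 N : (0 < N)%N ->
  a * lam ^+ 2 * M <= (1 + a * lam ^+ 2 - u * (lam * h)) * N%:R ->
  lam ^+ 2 *: res (B0 N) <=1 B0 N.+2.
Proof.
move=> N0 hN x; rewrite bm_scaleE residualE.
have P2 : lam ^+ 2 * opow P 2 (B0 N) x <= lam * P (B1 N.+1) x.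
  rewrite expr2 -mulrA ler_pM2l//.
  by have := op_le Ppos (stepB0 N) x; rewrite linearZ.
case: (iA01 x) => hx; first by rewrite hx mulr0 subr0 -stepB1_off.
have -> : B0 N.+2 x = 1.
  rewrite /B0 [hit_par false _]hit_parS [hit_par true _]hit_parS add0r.
  by rewrite !bm_addE !bm_scaleE !(taboo_on _ _ hx) !mulr0 !addr0.
rewrite hx mulr1; set s := nu (opow (taboo P iA) N 1).
have s1 : N%:R * s <= M.
  have : N%:R *: opow (taboo P iA) N 1 <=1 M *: (1 : bmfun R X).
    by move=> y; rewrite !bm_scaleE mulr1; apply: survival_le.
  by move=> /(functional_le nupos); rewrite !linearZ /= nu1 mulr1.
have s2 : 1 - s <= nu (B0 N).
  by have := functional_le nupos (@B0_lower N); rewrite linearB nu1.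
have NR : 0 < N%:R :> R by rewrite ltr0n.
have aL : 0 <= a * lam ^+ 2 by rewrite mulr_ge0// sqr_ge0.
have s3 : a * lam ^+ 2 * s <= 1 + a * lam ^+ 2 - u * (lam * h).
  rewrite -(ler_pM2r NR); apply: le_trans hN.
  by have := ler_wpM2l aL s1; rewrite mulrCA mulrC.
have s4 := ler_wpM2l aL s2.
have := stepB1_on N.+1 x; lra.
Qed.

Lemma two_step_tail :
  exists C, forall n x, (lam ^+ 2) ^+ n * opow res n 1 x <= C.
Proof.
set K := 1 + a * lam ^+ 2 - u * (lam * h).
have K0 : 0 < K by rewrite subr_gt0.
have M0 : 0 <= M by have := hM 0 point; rewrite big_ord0.
have aL : 0 <= a * lam ^+ 2 by rewrite mulr_ge0// sqr_ge0.
have T1 : 0 <= (a * lam ^+ 2 * M) / K by apply: divr_ge0; [apply: mulr_ge0|apply: ltW].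
(* The first summand makes [res_B0] applicable from [N0] on; 2M brings the survival probability at
   [N0] down to 1/2, so that 1 <= 2 [B0 N0]; the last 1 keeps [N0] positive. *)
pose T := (a * lam ^+ 2 * M) / K + 2 * M + 1.
have [N0 TN0] : exists N0 : nat, T <= N0%:R.
  by exists (Num.bound T); apply/ltW/archi_boundP; rewrite /T; lra.
have N00 : (0 < N0)%N by rewrite -(ltr0n R); apply: lt_le_trans TN0; rewrite /T; lra.
have hN N : (N0 <= N)%N -> a * lam ^+ 2 * M <= K * N%:R.
  rewrite -(ler_nat R) => N0N; rewrite mulrC [leRHS]mulrC -ler_pdivrMr// mulrC.
  apply: le_trans (le_trans TN0 N0N); rewrite /T; lra.
have rpos : positive_op res by exact: residual_positive minorization2.
have main n : (lam ^+ 2) ^+ n *: opow res n (B0 N0) <=1 B0 (N0 + n.*2)%N.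
  elim: n => [|n ih] x; first by rewrite addn0 expr0 scale1r.
  rewrite doubleS !addnS.
  apply: le_trans (res_B0 (N := (N0 + n.*2)%N) _ _ x).
  - have := op_le rpos ih x; rewrite linearZ => h'.
    rewrite !bm_scaleE opowS exprS -mulrA ler_wpM2l ?sqr_ge0//.
  - by rewrite addn_gt0 N00.
  - by apply: hN; rewrite leq_addr.
exists (2 * (u * h)) => n x.
have L0 : 0 <= (lam ^+ 2) ^+ n by rewrite exprn_ge0// sqr_ge0.
have half : (1 : bmfun R X) <=1 2 *: B0 N0.
  move=> y; rewrite bm_scaleE bm_1E.
  have := B0_lower N0 y; rewrite bm_addE bm_oppE bm_1E.
  have := survival_le N0 y.
  have := survival_ge0 Ppos iA01 N0 y; rewrite bm_0E.
  set s := bm_val _ _; move=> s0 sM.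
  have : s <= 2^-1.
    have NR : 0 < N0%:R :> R by rewrite ltr0n.
    rewrite -(ler_pM2l NR); apply: le_trans sM _.
    by rewrite ler_pdivlMr//; apply: le_trans TN0; rewrite /T; lra.
  lra.
have := op_le (opow_positive n rpos) half x.
rewrite linearZ bm_scaleE => /(ler_wpM2l L0) /le_trans; apply.
rewrite mulrCA ler_pM2l//; have := main n x; rewrite bm_scaleE => /le_trans; apply.
rewrite /B0 bm_addE bm_scaleE.
have g1 := hit_par_le_gen (N0 + n.*2) x; rewrite bm_addE in g1.
have g2 := hit_gen_le Ppos P1 iA01 lam1 hM (N0 + n.*2) x Mlam.
have := hit_par_ge0 false (N0 + n.*2) x; have := hit_par_ge0 true (N0 + n.*2) x.
rewrite bm_0E; move: g1 g2 u1; set e := bm_val _ _; set o := bm_val _ _.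
set v := u; nra.
Qed.

End TwoStepRegeneration.

(** * Decay in L^2 of the density of the regeneration measure *)

Section L2Decay.
Context (R : realType) (d : measure_display) (X : measurableType d).
Implicit Types f g : bmfun R X.

(** The quadratic t -> pi((f + t g)^2) is nonnegative; it is evaluated at its minimum. *)
Lemma functional_CauchySchwarz (pi : {scalar bmfun R X}) f g :
  (forall f, 0 <=1 f -> 0 <= pi f) ->
  pi (f * g) ^+ 2 <= pi (f * f) * pi (g * g).
Proof.
move=> pipos.
have sq (k : bmfun R X) : 0 <= pi (k * k).
  by apply: pipos => x; rewrite bm_mulE -expr2 sqr_ge0.
have quad t : 0 <= pi (f * f) + 2 * t * pi (f * g) + t ^+ 2 * pi (g * g).
  have := sq (f + t *: g).
  have -> : (f + t *: g) * (f + t *: g) =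
      f * f + (2 * t) *: (f * g) + (t ^+ 2) *: (g * g).
    by apply/bmfunP => x; rewrite !(bm_addE, bm_mulE, bm_scaleE); ring.
  by rewrite !linearD !linearZ.
move: (sq f) (sq g) quad.
set A := pi (f * f); set B := pi (f * g); set C := pi (g * g) => A0 C0 quad.
have [C1|] := ltP 0 C.
  have := quad (- B / C).
  have -> : A + 2 * (- B / C) * B + (- B / C) ^+ 2 * C = (A * C - B ^+ 2) / C.
    by field; rewrite gt_eqF.
  by rewrite pmulr_lge0 ?invr_gt0// subr_ge0.
move=> C1; have CE : C = 0 by apply/eqP; rewrite eq_le C1 C0.
have [->|B0] := eqVneq B 0; first by rewrite expr0n CE mulr0.
(* For C = 0 the quadratic is affine in t, and this t gives it the value -1. *)
have := quad (- (A + 1) / (2 * B)).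
have -> : A + 2 * (- (A + 1) / (2 * B)) * B + (- (A + 1) / (2 * B)) ^+ 2 * C = -1.
  by rewrite CE; field.
by rewrite lerNr oppr0 ler10.
Qed.

(* The supremum S of y satisfies S^2 <= y 0 * S. *)
Lemma bounded_le_first (y : nat -> R) C :
  (forall n, 0 <= y n) -> (forall n, y n <= C) ->
  (forall n, y n ^+ 2 <= y 0%N * y n.*2) -> forall n, y n <= y 0%N.
Proof.
move=> y0 yC ysq n.
have hs : has_sup (range y).
  by split; [exists (y 0%N); exists 0%N|exists C => _ [k _ <-]].
pose S := sup (range y).
have yS k : y k <= S by apply: sup_upper_bound => //; exists k.
have S0 : 0 <= S by apply: le_trans (yS 0%N).
suff SS : S <= y 0%N by apply: le_trans (yS n) SS.
have : S <= Num.sqrt (y 0%N * S).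
  apply: ge_sup; first by case: hs.
  move=> _ [k _ <-]; rewrite -[leLHS]ger0_norm// -sqrtr_sqr ler_wsqrtr//.
  by apply: le_trans (ysq k) _; rewrite ler_wpM2l.
rewrite -(ler_pXn2r (ltn0Sn 1)) ?nnegrE ?sqrtr_ge0//.
rewrite sqr_sqrtr ?mulr_ge0// expr2.
by have [S1|S1 _] := ltP 0 S; [rewrite ler_pM2r|apply: le_trans S1 _].
Qed.

Variables (P : {linear bmfun R X -> bmfun R X}).
Variables (pi nu : {scalar bmfun R X}) (iA g : bmfun R X).
Variables (a lam C : R).
Hypothesis P1 : P 1 = 1.
Hypotheses (pipos : forall f, 0 <=1 f -> 0 <= pi f) (pi1 : pi 1 = 1).
Hypotheses (nu1 : nu 1 = 1) (nupos : forall f, 0 <=1 f -> 0 <= nu f).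
Hypothesis P_symmetric : forall f k, pi (f * P k) = pi (P f * k).
Hypothesis density : forall f, nu f = pi (g * f).
Hypotheses (a0 : 0 < a) (piA : 0 < pi iA) (lam0 : 0 < lam).
Hypothesis g_le : g <=1 (a * pi iA)^-1 *: (1 : bmfun R X).
Hypothesis minorization2 : forall f, 0 <=1 f -> (a * nu f) *: iA <=1 opow P 2 f.
Local Notation res := (residual (opow P 2) nu iA a).
Hypothesis tail : forall n x, (lam ^+ 2) ^+ n * opow res n 1 x <= C.

Lemma invariant_op f : pi (P f) = pi f.
Proof. by rewrite -[P f]mul1r P_symmetric P1 mul1r. Qed.

Lemma invariant_opow n f : pi (opow P n f) = pi f.
Proof. by elim: n => [//|n ih]; rewrite opowS invariant_op. Qed.

Lemma opow_symmetric n f k : pi (f * opow P n k) = pi (opow P n f * k).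
Proof.
elim: n f k => [//|n ih] f k; rewrite opowSr ih P_symmetric.
by rewrite -opowS.
Qed.

Lemma opow_opow m n f : opow (opow P m) n f = opow P (n * m) f.
Proof. by rewrite /opow iterM. Qed.

Lemma opow1 n : opow P n 1 = 1.
Proof. by elim: n => [//|n ih]; rewrite opowS ih. Qed.

Let f0 : bmfun R X := g - 1.
Let v n := pi (opow P n f0 * opow P n f0).

Let pi_f0 : pi f0 = 0.
Proof. by rewrite linearB pi1 -[g]mulr1 -density nu1 subrr. Qed.

(** Self-adjointness moves all powers of P onto one factor. Writing g = f0 + 1, the constant
    contributes pi(f0) = 0. *)
Let vE n : v n = nu (opow (opow P 2) n f0).
Proof.
rewrite density opow_opow muln2 -addnn opowD -[g](subrK 1) -/f0 mulrDl mul1r.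
rewrite linearD -opowD invariant_opow pi_f0 addr0 opowD.
by rewrite opow_symmetric.
Qed.

Let v_ge0 n : 0 <= v n.
Proof. by apply: pipos => x; rewrite bm_mulE -expr2 sqr_ge0. Qed.

(** The squared norm of g - 1 is pi(g^2) - 1 = nu(g) - 1, and g is bounded. *)
Let v0_le : v 0 <= (a * pi iA)^-1 - 1.
Proof.
rewrite /v opow0.
have -> : f0 * f0 = g * g - g - f0.
  by apply/bmfunP => x; rewrite !(bm_addE, bm_mulE, bm_oppE, bm_1E); ring.
rewrite linearB pi_f0 subr0 linearB -[X in _ - pi X]mulr1 -!density nu1 lerB//.
apply: le_trans (functional_le nupos g_le) _.
by rewrite linearZ /= nu1 mulr1.
Qed.

Let v_sq n : v n ^+ 2 <= v 0%N * v n.*2.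
Proof.
have -> : v n = pi (f0 * opow P n.*2 f0).
  by rewrite -addnn opowD opow_symmetric.
exact: functional_CauchySchwarz.
Qed.

Let v_bounded : exists C', forall n, (lam ^+ 2) ^+ n * v n <= C'.
Proof.
have /bounded_measurableP[_ [K hK]] := bm_valP f0.
have aA : 0 < a * pi iA by rewrite mulr_gt0.
have rpos : positive_op res by exact: residual_positive minorization2.
have L0 : 0 < lam ^+ 2 by rewrite exprn_gt0.
have K0 : 0 <= K by apply: le_trans (hK point).
(* The renewal sum up to [n] is governed by the tail at [n.+1], hence the division by [lam ^+ 2];
   [K] bounds f0. *)
exists (K * C / (a * pi iA) / lam ^+ 2) => n.
have P21 : opow P 2 1 = 1 by exact: opow1.
have le1 : v n <= \sum_(k < n.+1) nu (opow res k 1) * v (n - k)%N.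
  rewrite big_ord_recl opow0 nu1 mul1r subn0 lerDl; apply: sumr_ge0 => k _.
  apply: mulr_ge0 => //; apply: nupos; apply: opow_positive => //.
move: le1; under eq_bigr do rewrite vE; move=> le1.
rewrite (renewal_identity iA a P21 nu1) in le1.
have inv2 (f : bmfun R X) : pi (opow P 2 f) = pi f by exact: invariant_opow.
have e := stationary_regeneration nu iA a n.+1 f0 inv2.
rewrite pi_f0 sub0r in e.
have le2 : - pi (opow res n.+1 f0) <= K * (C / (lam ^+ 2) ^+ n.+1).
  rewrite -linearN; have : - opow res n.+1 f0 <=1 (K * (C / (lam ^+ 2) ^+ n.+1)) *: (1 : bmfun R X).
    move=> x; rewrite bm_oppE bm_scaleE bm_1E mulr1.
    apply: le_trans (ler_norm _) _; rewrite normrN.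
    apply: le_trans (opow_norm_le _ _ rpos hK) _.
    by rewrite ler_wpM2l// ler_pdivlMr ?exprn_gt0// mulrC.
  by move=> /(functional_le pipos); rewrite linearZ /= pi1 mulr1.
rewrite -e in le2.
have := ler_wpM2l (ltW aA) le1 => /le_trans /(_ le2).
rewrite exprS => h; rewrite ler_pdivlMr// ler_pdivlMr//.
have Ln : 0 < (lam ^+ 2) ^+ n by rewrite exprn_gt0.
have := ler_wpM2l (ltW (mulr_gt0 L0 Ln)) h.
have -> : lam ^+ 2 * (lam ^+ 2) ^+ n * (K * (C / (lam ^+ 2 * (lam ^+ 2) ^+ n))) = K * C.
  by field; rewrite !gt_eqF//.
by move=> h'; apply: le_trans h'; rewrite le_eqVlt; apply/orP; left; apply/eqP; ring.
Qed.

(** The rescaled sequence lam^(2n) v_n inherits v_n^2 <= v_0 v_(2n), so mere boundedness improves to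
    a bound by its first term and the tail constant disappears. *)
Lemma density_decay n : (lam ^+ 2) ^+ n * v n <= (a * pi iA)^-1 - 1.
Proof.
have [C' hC'] := v_bounded.
apply: le_trans v0_le.
rewrite -[leRHS]mul1r.
apply: (@bounded_le_first (fun n => (lam ^+ 2) ^+ n * v n) C') => // {n} n.
  by rewrite mulr_ge0// exprn_ge0// sqr_ge0.
rewrite expr0 mul1r exprMn -muln2 [X in _ <= _ * (X * _)]exprM [leRHS]mulrCA muln2 ler_wpM2l//.
by rewrite sqr_ge0.
Qed.

(** The difference equals pi(P^n (g - 1) f); Cauchy-Schwarz with pi(f^2) <= 1 leaves the square root
    of v_n. *)
Lemma regeneration_decay n f : (forall x, `|f x| <= 1) ->
  `|nu (opow P n f) - pi f| <= Num.sqrt ((a * pi iA)^-1 - 1) / lam ^+ n.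
Proof.
move=> f1.
have -> : nu (opow P n f) - pi f = pi (opow P n f0 * f).
  rewrite -opow_symmetric density -[in LHS](invariant_opow n f).
  by rewrite -linearB mulrBl mul1r.
rewrite -sqrtr_sqr.
have Ln : 0 < lam ^+ n by rewrite exprn_gt0.
have -> : Num.sqrt ((a * pi iA)^-1 - 1) / lam ^+ n =
    Num.sqrt (((a * pi iA)^-1 - 1) / (lam ^+ 2) ^+ n).
  rewrite sqrtrM; last by apply: le_trans v0_le.
  have -> : ((lam ^+ 2) ^+ n)^-1 = ((lam ^+ n)^-1) ^+ 2 by rewrite exprVn -!exprM mulnC.
  by rewrite sqrtr_sqr ger0_norm// ltW// invr_gt0.
apply: ler_wsqrtr; rewrite ler_pdivlMr ?exprn_gt0//.
apply: le_trans (density_decay n); rewrite mulrC ler_wpM2l//.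
  by rewrite exprn_ge0// sqr_ge0.
apply: le_trans (functional_CauchySchwarz _ _ pipos) _.
rewrite -[leRHS]mulr1; apply: ler_wpM2l; first exact: v_ge0.
have ff : f * f <=1 1.
  by move=> x; rewrite bm_mulE bm_1E -expr2 -real_normK ?num_real// exprn_ile1.
by have := functional_le pipos ff; rewrite pi1.
Qed.

End L2Decay.

(** * The rate for an abstract reversible operator *)

Section Constants.
Variable R : realType.

(** For a = 0 the right side of the condition would be at most 1. *)
Lemma minorization_mass_gt0 (a p lam theta : R) :
  0 <= a -> 0 < p -> p <= 1 -> 1 < lam -> 0 <= theta -> theta < 1 ->
  lam ^+ 2 < (1 - theta) * p ^+ 2 * (1 + a * lam ^+ 2) -> 0 < a.
Proof.
move=> a0 p0 p1 lam1 th0 th1 hlam; rewrite lt_neqAle a0 andbT.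
apply: contraL hlam => /eqP <-; rewrite mul0r addr0 mulr1 -leNgt.
apply: le_trans (_ : 1 <= _); last by rewrite exprn_ege1// ltW.
apply: mulr_ile1; [by rewrite subr_ge0 ltW|exact: sqr_ge0| |].
  by rewrite lerBlDr lerDl.
by rewrite exprn_ile1// ltW.
Qed.

(** Derives what both regenerations require from the single condition on [lam]; [p] is 1/h. The
    two-step condition is that inequality divided by (1 - theta) p^2. The one-step condition follows
    from 1 + a lam^2 <= (1 + delta lam)^2 by taking roots. The last item compares m h with M_3. *)
Lemma regeneration_constants (delta a p lam theta : R) :
  0 < delta -> delta <= 1 -> 0 <= a -> a <= delta ^+ 2 ->
  0 < p -> p <= 1 -> 1 < lam -> 0 <= theta -> theta < 1 ->
  lam ^+ 2 < (1 - theta) * p ^+ 2 * (1 + a * lam ^+ 2) ->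
  [/\ 0 < a,
      0 < 1 + delta * lam - lam * p^-1,
      lam * p^-1 / (1 - theta) * (lam * p^-1) < 1 + a * lam ^+ 2 &
      delta * lam / (1 + delta * lam - lam * p^-1) * p^-1 <=
      a * lam ^+ 2 / ((1 - theta) * p ^+ 2 * (1 + a * lam ^+ 2) - lam ^+ 2)].
Proof.
move=> d0 d1 a0 ad p0 p1 lam1 th0 th1 hlam.
have lam0 : 0 < lam by exact: lt_trans lam1.
have Kle : (1 - theta) * p ^+ 2 * (1 + a * lam ^+ 2) <= p ^+ 2 * (1 + a * lam ^+ 2).
  apply: ler_wpM2r; first by rewrite addr_ge0// mulr_ge0// sqr_ge0.
  by rewrite ler_piMl ?sqr_ge0// lerBlDr lerDl.
have hlam' := lt_le_trans hlam Kle.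
have pp : p ^+ 2 <= p by rewrite expr2 ler_piMl// ltW.
have pos : lam < p * (1 + delta * lam).
  have dl : 0 < delta * lam by rewrite mulr_gt0.
  rewrite -(ltr_pXn2r (ltn0Sn 1)) ?nnegrE ?ltW//; last by rewrite mulr_gt0// addr_gt0.
  apply: lt_le_trans hlam' _; rewrite exprMn ler_wpM2l ?sqr_ge0//.
  have : a * lam ^+ 2 <= delta ^+ 2 * lam ^+ 2 by rewrite ler_wpM2r ?sqr_ge0.
  rewrite -exprMn sqrrD expr1n mul1r; lra.
have geo : 0 < 1 + delta * lam - lam * p^-1.
  by rewrite subr_gt0 ltr_pdivrMr// mulrC.
split => //.
- exact: minorization_mass_gt0 hlam.
- have -> : lam * p^-1 / (1 - theta) * (lam * p^-1) =
      lam ^+ 2 / ((1 - theta) * p ^+ 2).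
    by field; rewrite subr_eq0 !gt_eqF.
  by rewrite ltr_pdivrMr ?mulr_gt0 ?subr_gt0 ?exprn_gt0// mulrC.
- have -> : delta * lam / (1 + delta * lam - lam * p^-1) * p^-1 =
      delta * lam / (p * (1 + delta * lam) - lam).
    by field; rewrite !gt_eqF// subr_gt0.
  rewrite ler_pdivrMr ?subr_gt0// mulrAC ler_pdivlMr ?subr_gt0//.
  set K := (1 - theta) * _ * _ in hlam Kle *.
  have H1 : delta * lam * (K - lam ^+ 2) <=
      delta * lam * (p ^+ 2 * (1 + a * lam ^+ 2) - lam ^+ 2).
    by apply: ler_wpM2l; [rewrite mulr_ge0// ltW | rewrite lerD2r].
  apply: le_trans H1 _.
  have adelta : a <= delta by apply: le_trans ad _; rewrite expr2 ler_piMl// ltW.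
  have pl : 0 <= lam - p by rewrite subr_ge0; apply: le_trans p1 (ltW lam1).
  have H2 : a * lam <= delta * (lam + p).
    rewrite mulrDr; apply: le_trans (_ : delta * lam <= _).
      by rewrite ler_pM2r.
    by rewrite lerDl mulr_ge0// ltW.
  have H3 := ler_wpM2r pl H2.
  have H4 : delta * a * lam ^+ 2 * p ^+ 2 <= delta * a * lam ^+ 2 * p.
    by apply: ler_wpM2l => //; rewrite !mulr_ge0// ?sqr_ge0// ltW.
  rewrite -subr_ge0.
  (* The cross-multiplied difference is lam times two terms, nonnegative by a <= delta, p <= lam and
     p^2 <= p. *)
  have -> : a * lam ^+ 2 * (p * (1 + delta * lam) - lam) -
     delta * lam * (p ^+ 2 * (1 + a * lam ^+ 2) - lam ^+ 2) =
     lam * ((delta * (lam + p) * (lam - p) - a * lam * (lam - p)) +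
      (delta * a * lam ^+ 2 * p - delta * a * lam ^+ 2 * p ^+ 2)) by ring.
  by rewrite mulr_ge0 ?(ltW lam0)// addr_ge0// subr_ge0.
Qed.

(** Summation by parts. When [q k] is P(T > k), the left side is E[lam^T; T <= n]. *)
Lemma abel_geometric (q : nat -> R) lam n :
  \sum_(k < n) (q k - q k.+1) * lam ^+ k.+1 =
  q 0%N - q n * lam ^+ n + (lam - 1) * \sum_(k < n) q k * lam ^+ k.
Proof.
elim: n => [|n ih]; first by rewrite !big_ord0 expr0; ring.
by rewrite !big_ord_recr ih /= exprS; ring.
Qed.

End Constants.

(** * Assembling the bound from the first regeneration time *)

Section Rate.
Context (R : realType) (d : measure_display) (X : measurableType d).
Variables (P : {linear bmfun R X -> bmfun R X}).
Variables (pi nu : {scalar bmfun R X}) (iA g : bmfun R X).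
Variables (delta lam theta M : R).
Hypotheses (Ppos : positive_op P) (P1 : P 1 = 1).
Hypothesis iA01 : forall x, iA x = 0 \/ iA x = 1.
Hypotheses (pipos : forall f, 0 <=1 f -> 0 <= pi f) (pi1 : pi 1 = 1).
Hypotheses (nupos : forall f, 0 <=1 f -> 0 <= nu f) (nu1 : nu 1 = 1).
Hypothesis P_symmetric : forall f k, pi (f * P k) = pi (P f * k).
Hypotheses (delta0 : 0 < delta) (lam1 : 1 < lam).
Hypothesis minorization : forall f, 0 <=1 f -> (delta * nu f) *: iA <=1 P f.
Hypothesis hM : forall N x, \sum_(k < N) opow (taboo P iA) k.+1 1 x <= M.
Hypothesis Mlam : M * ln lam < 1.
Hypotheses (theta0 : 0 <= theta) (theta1 : theta < 1).
Hypothesis htheta : forall N x, iA x = 1 -> lam * P (hit_par P iA lam true N) x <= theta.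
Hypothesis hlambda : lam ^+ 2 < (1 - theta) * (1 - M * ln lam) ^+ 2
  * (1 + delta ^+ 2 * nu iA * lam ^+ 2).
Hypothesis piA : 0 < pi iA.
Hypothesis density : forall f, nu f = pi (g * f).
Hypothesis g_le : g <=1 (delta ^+ 2 * nu iA * pi iA)^-1 *: (1 : bmfun R X).

Let C3 : R := Num.sqrt ((delta ^+ 2 * nu iA * pi iA)^-1 - 1).
Let M3 : R := delta ^+ 2 * nu iA * lam ^+ 2
     / ((1 - theta) * (1 - M * ln lam) ^+ 2
          * (1 + delta ^+ 2 * nu iA * lam ^+ 2) - lam ^+ 2).
Let D3 : R := C3 * lam + Num.max (2 - C3) 0 * lam^-1 * M3.
Let E3 : R := C3 * (lam - lam^-1) * M3 / 2.

Local Notation res := (residual P nu iA delta).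

Lemma deviation_le n (f : bmfun R X) x : (forall x, `|f x| <= 1) ->
  `|opow P n f x - pi f| <= (D3 + E3 * n%:R) * lam ^- n.
Proof.
move=> f1; have lam0 : 0 < lam by exact: lt_trans lam1.
have [x0 hx0] : exists x, iA x = 1.
  apply: contrapT => /forallNP nA.
  have e : iA = 0 by apply/bmfunP => y; case: (iA01 y) => // /nA.
  by move: piA; rewrite e linear0 ltxx.
have iApos : 0 <=1 iA by move=> y; case: (iA01 y) => ->.
have iAle : iA <=1 1 by move=> y; case: (iA01 y) => ->; rewrite bm_1E ?ler01.
have one0 : (0 : bmfun R X) <=1 1 by move=> y; rewrite bm_1E ler01.
have delta1 : delta <= 1.
  have := minorization one0 x0.
  by rewrite P1 bm_scaleE hx0 nu1 !mulr1.
have nuA1 : nu iA <= 1 by rewrite -nu1; apply: functional_le.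
have nuA0 : 0 <= nu iA by exact: nupos.
set a := delta ^+ 2 * nu iA.
have a0' : 0 <= a by rewrite mulr_ge0// sqr_ge0.
have ad : a <= delta ^+ 2 by rewrite ler_piMr// sqr_ge0.
have M0 : 0 <= M by have := hM 0 point; rewrite big_ord0.
have p0 : 0 < 1 - M * ln lam by rewrite subr_gt0.
have p1 : 1 - M * ln lam <= 1 by rewrite gerBl mulr_ge0// ln_ge0// ltW.
have [a0 geo1 geo2 mM3] :=
  regeneration_constants delta0 delta1 a0' ad p0 p1 lam1 theta0 theta1 hlambda.
have [C hC] := two_step_tail Ppos P1 iA01 nupos nu1 delta0 lam1 minorization
  hM Mlam theta0 theta1 htheta geo2.
have minor2 := minorization2 Ppos iA01 nupos delta0 minorization.
have decay := regeneration_decay P1 pipos pi1 nu1 nupos P_symmetric density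
  a0 piA lam0 g_le minor2 hC.
pose q k := opow res k 1 x.
have q_le k : lam ^+ k.+1 * q k <= M3.
  apply: le_trans mM3.
  exact: (one_step_tail Ppos P1 iA01 nupos nu1 delta0 lam1 minorization hM Mlam geo1).
have rpos : positive_op res by exact: residual_positive minorization.
have q0 k : 0 <= q k by exact: (opow_positive k rpos one0).
(* Centring [f] makes the contribution after a regeneration decay; without regeneration only |psi|
   <= 2 is available. *)
pose psi : bmfun R X := f - pi f *: (1 : bmfun R X).
have pif : `|pi f| <= 1.
  have h (k : bmfun R X) : (forall y, k y <= 1) -> pi k <= 1.
    by move=> k1; rewrite -pi1; apply: functional_le.
  rewrite ler_norml lerNl -linearN !h// => y;
    by move: (f1 y); rewrite ler_norml => /andP[]// h1 _; rewrite bm_oppE lerNl.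
have psi2 y : `|psi y| <= 2.
  rewrite /psi bm_addE bm_oppE bm_scaleE bm_1E mulr1.
  by apply: le_trans (ler_normB _ _) _; rewrite -[2]/(1 + 1) lerD.
have Ppsi k : opow P k psi = opow P k f - pi f *: (1 : bmfun R X).
  by rewrite linearB linearZ /= opow1.
have -> : opow P n f x - pi f = opow P n psi x.
  by rewrite Ppsi bm_addE bm_oppE bm_scaleE bm_1E mulr1.
rewrite (first_regeneration P nu iA delta) bm_addE bm_sumE.
apply: le_trans (ler_normD _ _) _.
have t1 : `|opow res n psi x| <= 2 * q n by exact: opow_norm_le.
(* A regeneration at step [k.+1] leaves [n - k.+1] steps started from [nu], which deviate by at most
   C_3 lam^(k+1-n). *)
have t2 : `|\sum_(i < n) (nu (opow P (n - i.+1) psi) *: (delta *: opow res i iA)) x|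
   <= C3 / lam ^+ n * \sum_(k < n) (q k - q k.+1) * lam ^+ k.+1.
  apply: le_trans (ler_norm_sum _ _ _) _; rewrite mulr_sumr.
  apply: ler_sum => k _.
  rewrite bm_scaleE (residual_pow_iA _ _ P1 nu1) bm_addE bm_oppE normrM.
  have qd : 0 <= q k - q k.+1.
    have : 0 <=1 delta *: opow res k iA.
      move=> y; rewrite bm_scaleE; apply: mulr_ge0; first exact: ltW.
      exact: (opow_positive k rpos iApos y).
    by move=> /(_ x); rewrite (residual_pow_iA _ _ P1 nu1).
  rewrite [`|_ - _|]ger0_norm// mulrCA mulrC; apply: ler_wpM2l => //.
  rewrite Ppsi linearB linearZ /= nu1 mulr1.
  apply: le_trans (decay _ _ f1) _; rewrite -/C3 -mulrA ler_wpM2l ?sqrtr_ge0//.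
  rewrite -[leLHS]mul1r ler_pdivrMr ?exprn_gt0// -mulrA -exprD addnC subnK// mulVf//.
  by rewrite gt_eqF// exprn_gt0.
apply: le_trans (lerD t1 t2) _.
have Ln : 0 < lam ^+ n by rewrite exprn_gt0.
rewrite -(ler_pM2r Ln) mulfVK ?gt_eqF//.
rewrite abel_geometric.
have C30 : 0 <= C3 by exact: sqrtr_ge0.
have lamV : lam * lam^-1 = 1 by rewrite mulfV// gt_eqF.
have lamV0 : 0 < lam^-1 by rewrite invr_gt0.
have qV k : q k * lam ^+ k <= lam^-1 * M3.
  rewrite -(ler_pM2l lam0) [leRHS]mulrA lamV mul1r; apply: le_trans (q_le k).
  by rewrite exprS mulrCA mulrC.
have M30 : 0 <= M3 by apply: le_trans (q_le 0); rewrite mulr_ge0// exprn_ge0// ltW.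
have qsum : (lam - 1) * \sum_(k < n) q k * lam ^+ k <= n%:R * ((1 - lam^-1) * M3).
  have : \sum_(k < n) q k * lam ^+ k <= n%:R * (lam^-1 * M3).
    rewrite mulr_natl -[X in _ *+ X]card_ord -sumr_const; apply: ler_sum => k _.
    exact: qV.
  have l10 : 0 <= lam - 1 by rewrite subr_ge0 ltW.
  move=> /(ler_wpM2l l10)/le_trans; apply.
  rewrite le_eqVlt; apply/orP; left; apply/eqP.
  transitivity (n%:R * ((lam * lam^-1 - lam^-1) * M3)); [ring|by rewrite lamV].
have q01 : q 0%N = 1 by [].
rewrite q01 mulrDl.
have -> : C3 / lam ^+ n * (1 - q n * lam ^+ n + (lam - 1) * \sum_(k < n) q k * lam ^+ k)
   * lam ^+ n =
   C3 * (1 - q n * lam ^+ n + (lam - 1) * \sum_(k < n) q k * lam ^+ k).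
  by rewrite mulrAC divfK// gt_eqF.
have e1 := ler_wpM2l C30 qsum.
(* The survival term brings 2 and the summation by parts brings -C_3, which explains the positive
   part in D_3. *)
have e2 : (2 - C3) * (q n * lam ^+ n) <= Num.max (2 - C3) 0 * lam^-1 * M3.
  rewrite -mulrA; apply: le_trans (_ : Num.max (2 - C3) 0 * (q n * lam ^+ n) <= _).
    by apply: ler_wpM2r; [rewrite mulr_ge0// ltW|rewrite le_max lexx].
  by apply: ler_wpM2l => //; rewrite le_max lexx orbT.
have e3 : C3 <= C3 * lam by rewrite ler_peMr// ltW.
(* Uses 1 - 1/lam <= (lam - 1/lam)/2, that is lam + 1/lam >= 2; this is the origin of the 2 in
   E_3. *)
have e4 : C3 * (n%:R * ((1 - lam^-1) * M3)) <= E3 * n%:R.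
  rewrite /E3.
  have -> : C3 * (lam - lam^-1) * M3 / 2 * n%:R =
     C3 * (n%:R * ((lam - lam^-1) / 2 * M3)) by ring.
  do 2 (apply: ler_wpM2l => //); apply: ler_wpM2r => //.
  rewrite ler_pdivlMr//.
  have : 0 <= (lam - 1) * (1 - lam^-1) by rewrite mulr_ge0// subr_ge0 ?invf_le1// ltW.
  by rewrite mulrBl mulrBr mulrBr lamV; lra.
rewrite /D3; lra.
Qed.

End Rate.

(** * Kernels as operators *)

Section Functionals.
Context (R : realType) (d : measure_display) (X : measurableType d).
Implicit Types (f g : bmfun R X).

Lemma bm_measurable f : measurable_fun [set: X] f.
Proof. by case/bounded_measurableP: (bm_valP f). Qed.

Lemma bm_bounded f : exists C, 0 < C /\ forall x, `|f x| <= C.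
Proof.
case/bounded_measurableP: (bm_valP f) => _ [C hC]; exists (`|C| + 1); split.
  by rewrite ltr_wpDl.
by move=> x; apply: le_trans (hC x) _; rewrite ler_wpDr// ler_norm.
Qed.

Fact bm_indic_subproof (A : set X) : measurable A ->
  (\1_A : X -> R) \in bounded_measurable (R := R) (X := X).
Proof.
move=> mA; apply/bounded_measurableP; split; first exact: measurable_indic.
by exists 1 => x; rewrite indicE; case: (x \in A); rewrite ?normr1 ?normr0.
Qed.

Definition bm_indic (A : set X) (mA : measurable A) : bmfun R X :=
  BMFun (bm_indic_subproof mA).

Lemma bm_indicE (A : set X) (mA : measurable A) x : bm_indic mA x = \1_A x.
Proof. by []. Qed.

(** The sum of indicators is the integer part of [t]. *)
Lemma layer_cake n (t : R) : 0 <= t <= n%:R ->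
  0 <= t - \sum_(k < n) ((k.+1)%:R <= t)%R%:R <= 1.
Proof.
elim: n => [|n ih] /andP[t0 tn].
  by rewrite big_ord0 subr0 t0/= (le_trans tn).
rewrite big_ord_recr /=; have [tn'|nt] := leP t n%:R.
  have -> : (n.+1%:R <= t) = false.
    by apply/negbTE; rewrite -ltNge (le_lt_trans tn')// ltr_nat.
  by rewrite addr0; apply: ih; rewrite t0.
have -> : \sum_(k < n) ((k.+1)%:R <= t)%R%:R = n%:R :> R.
  rewrite (eq_bigr (fun=> 1)) ?sumr_const ?card_ord// => k _.
  by rewrite (le_trans _ (ltW nt))// ler_nat.
move: tn; rewrite -natr1 => tn; case: (leP (n%:R + 1) t) => h /=;
  by rewrite ?mulr1n ?mulr0n; apply/andP; split; lra.
Qed.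

(* Uniform approximation of f by the step functions of [layer_cake]. *)
Lemma bounded_functional_ge0 (l : bmfun R X -> R) (K : R) : scalar l ->
  (forall f C, (forall x, `|f x| <= C) -> `|l f| <= K * C) ->
  (forall (B : set X) (mB : measurable B), 0 <= l (bm_indic mB)) ->
  forall f, 0 <=1 f -> 0 <= l f.
Proof.
move=> l_lin lK l_ind f f0.
have lD g k : l (g + k) = l g + l k by have := l_lin 1 g k; rewrite scale1r mul1r.
have l0 : l 0 = 0 by have := lD 0 0; rewrite addr0; lra.
have lZ c g : l (c *: g) = c * l g by have := l_lin c g 0; rewrite addr0 l0 addr0.
have lsum (I : Type) (r : seq I) (F : I -> bmfun R X) :
    l (\sum_(i <- r) F i) = \sum_(i <- r) l (F i).
  by elim/big_ind2: _ => // ? ? ? ? <- <-.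
have [C [C0 fC]] := bm_bounded f.
have mB k n : measurable [set x | k%:R * C / n%:R <= f x].
  rewrite [X in measurable X](_ : _ = f @^-1` `[k%:R * C / n%:R, +oo[).
    by rewrite -[X in measurable X]setTI; apply: bm_measurable.
  by apply/seteqP; split => x /=; rewrite in_itv/= andbT.
have lf n : (0 < n)%N -> - (K * (C / n%:R)) <= l f.
  move=> n0; have nR : 0 < n%:R :> R by rewrite ltr0n.
  pose fn := \sum_(k < n) (C / n%:R) *: bm_indic (mB k.+1 n).
  have fn0 : 0 <= l fn.
    rewrite lsum; apply: sumr_ge0 => k _; rewrite lZ mulr_ge0// divr_ge0// ltW//.
  have close x : `|(f - fn) x| <= C / n%:R.
    rewrite bm_addE bm_oppE bm_sumE.
    have t0 : 0 <= f x * n%:R / C <= n%:R.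
      rewrite divr_ge0 ?mulr_ge0 ?(ltW C0)//=; last exact: f0.
      rewrite ler_pdivrMr// mulrC ler_wpM2l//.
      exact: le_trans (ler_norm _) (fC x).
    have := layer_cake t0.
    have -> : \sum_(i < n) ((C / n%:R) *: bm_indic (mB i.+1 n)) x =
        C / n%:R * \sum_(k < n) ((k.+1)%:R <= f x * n%:R / C)%R%:R.
      rewrite mulr_sumr; apply: eq_bigr => k _; rewrite bm_scaleE bm_indicE indicE.
      congr (_ * (_ : bool)%:R); rewrite ler_pdivlMr//.
      apply/idP/idP; rewrite inE /=; rewrite ler_pdivrMr//.
    set s := \sum_(k < n) _ => hs.
    have -> : f x - C / n%:R * s = C / n%:R * (f x * n%:R / C - s).
      by field; rewrite !gt_eqF.
    case/andP: hs => s0 s1; rewrite normrM !ger0_norm ?divr_ge0 ?(ltW C0)//.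
    by rewrite ler_piMr// divr_ge0// ltW.
  have := lK _ _ close; rewrite ler_norml => /andP[h _].
  apply: le_trans h _; rewrite lD -scaleN1r lZ mulN1r gerDl.
  by rewrite oppr_le0.
have K0 : 0 <= K * C by apply: le_trans (lK f C fC).
rewrite leNgt; apply/negP => lneg.
have [n hn] : exists n : nat, K * C / (- l f) < n%:R.
  by exists (Num.bound (K * C / (- l f))); apply: archi_boundP; rewrite divr_ge0// oppr_ge0 ltW.
have n0 : (0 < n)%N.
  by rewrite -(ltr0n R) (le_lt_trans _ hn)// divr_ge0// oppr_ge0 ltW.
have nR : 0 < n%:R :> R by rewrite ltr0n.
move: hn; rewrite ltr_pdivrMr ?oppr_gt0// => hn.
have := lf n n0; rewrite lerNl mulrA ler_pdivlMr// => h.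
by move: hn; rewrite [n%:R * _]mulrC ltNge h.
Qed.

(** Serves to pass from sets to functions. The difference of the forms vanishes on indicators, hence
    is nonnegative with either sign on nonnegative functions; adding a constant makes any [f]
    nonnegative. *)
Lemma bounded_functional_eq (l1 l2 : bmfun R X -> R) (K1 K2 : R) :
  scalar l1 -> scalar l2 ->
  (forall f C, (forall x, `|f x| <= C) -> `|l1 f| <= K1 * C) ->
  (forall f C, (forall x, `|f x| <= C) -> `|l2 f| <= K2 * C) ->
  (forall (B : set X) (mB : measurable B), l1 (bm_indic mB) = l2 (bm_indic mB)) ->
  forall f, l1 f = l2 f.
Proof.
move=> lin1 lin2 b1 b2 e f.
have sub (m1 m2 : bmfun R X -> R) (L1 L2 : R) : scalar m1 -> scalar m2 ->
    (forall f C, (forall x, `|f x| <= C) -> `|m1 f| <= L1 * C) ->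
    (forall f C, (forall x, `|f x| <= C) -> `|m2 f| <= L2 * C) ->
    (forall (B : set X) (mB : measurable B), m1 (bm_indic mB) = m2 (bm_indic mB)) ->
    forall f, 0 <=1 f -> m2 f <= m1 f.
  move=> n1 n2 c1 c2 e' k k0; rewrite -subr_ge0.
  apply: (@bounded_functional_ge0 (fun f => m1 f - m2 f) (L1 + L2)) => //.
  - by move=> c f1 f2; rewrite n1 n2; ring.
  - move=> f1 C hC; apply: le_trans (ler_normB _ _) _.
    by rewrite mulrDl lerD// ?c1 ?c2.
  - by move=> B mB; rewrite e' subrr.
have pos k : 0 <=1 k -> l1 k = l2 k.
  move=> k0; apply/eqP; rewrite eq_le.
  by rewrite (sub _ _ _ _ lin2 lin1 b2 b1)// (sub _ _ _ _ lin1 lin2 b1 b2).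
have [C [C0 fC]] := bm_bounded f.
have h1 : 0 <=1 C *: (1 : bmfun R X) by move=> x; rewrite bm_scaleE bm_1E mulr1 ltW.
have h2 : 0 <=1 f + C *: (1 : bmfun R X).
  move=> x; rewrite bm_addE bm_scaleE bm_1E mulr1 -lerBlDr sub0r.
  by have := fC x; rewrite ler_norml => /andP[].
have := pos _ h2.
have := lin1 1 f (C *: (1 : bmfun R X)); have := lin2 1 f (C *: (1 : bmfun R X)).
rewrite !scale1r !mul1r => -> ->.
by rewrite (pos _ h1) => /addIr.
Qed.

End Functionals.

(** * Integrals of a function of a random point over an event *)

Section CompositeIntegral.
Context (R : realType) (d dT : measure_display).
Context (X : measurableType d) (T : measurableType dT).
Variables (mu : {measure set T -> \bar R}) (E : set T) (phi : T -> X).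
Hypotheses (mu1 : mu [set: T] = 1%E) (mE : measurable E).
Hypothesis mphi : measurable_fun [set: T] phi.
Implicit Types (f g : bmfun R X).

Let muE : (mu E <= 1)%E.
Proof. by rewrite -mu1; apply: le_measure; rewrite ?inE. Qed.

Lemma bm_comp_integrable f : mu.-integrable E (EFin \o (fun w => f (phi w))).
Proof.
apply: measurable_bounded_integrable => //.
- by apply: le_lt_trans muE _; rewrite ltry.
- apply: measurable_funTS; apply: measurableT_comp => //; exact: bm_measurable.
- have [C [C0 fC]] := bm_bounded f.
  by exists C; split; [exact: num_real|move=> D CD w _ /=; apply: le_trans (fC _) (ltW CD)].
Qed.

Lemma comp_integral_scalar :
  scalar (fun f : bmfun R X => \int[mu]_(w in E) f (phi w)).
Proof.
move=> c f g.
rewrite -RintegralZl//; last exact: bm_comp_integrable.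
rewrite -RintegralD//; first exact: bm_comp_integrable (c *: f).
exact: bm_comp_integrable.
Qed.

Lemma comp_integral_bound f C : (forall x, `|f x| <= C) ->
  `|\int[mu]_(w in E) f (phi w)| <= 1 * C.
Proof.
move=> fC; have C0 : 0 <= C by apply: le_trans (fC point).
apply: le_trans (le_normr_Rintegral mE (bm_comp_integrable f)) _.
apply: le_trans (_ : \int[mu]_(w in E) C <= _).
  apply: le_Rintegral => //.
  - exact: integrable_norm (bm_comp_integrable f).
  - apply: measurable_bounded_integrable => //; last exact: bounded_cst.
    by apply: le_lt_trans muE _; rewrite ltry.
rewrite Rintegral_cst// mulrC ler_wpM2r//.
by rewrite -lee_fin fineK// ge0_fin_numE// (le_lt_trans muE)// ltry.
Qed.

Lemma comp_integral_indic (B : set X) (mB : measurable B) :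
  \int[mu]_(w in E) bm_indic R mB (phi w) = fine (mu (E `&` phi @^-1` B)).
Proof.
have mphiB : measurable (phi @^-1` B).
  by rewrite -[X in measurable X]setTI; apply: mphi.
rewrite /Rintegral; congr fine.
transitivity (\int[mu]_(w in E) (\1_(phi @^-1` B) w)%:E)%E.
  by apply: eq_integral.
by rewrite integral_indic// setIC.
Qed.

End CompositeIntegral.

(** * The positive operator of a probability kernel *)

Section Kernel.
Context (R : realType) (d : measure_display) (X : measurableType d).
Implicit Types (f g : bmfun R X).

Definition expect (mu : {measure set X -> \bar R}) f : R := \int[mu]_x f x.

Lemma expect_scalar (mu : {measure set X -> \bar R}) : mu [set: X] = 1%E ->
  scalar (expect mu).
Proof. by move=> mu1; apply: (@comp_integral_scalar _ _ _ _ _ mu setT id). Qed.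

Lemma expect_bound (mu : {measure set X -> \bar R}) f C : mu [set: X] = 1%E ->
  (forall x, `|f x| <= C) -> `|expect mu f| <= 1 * C.
Proof. by move=> mu1; apply: (@comp_integral_bound _ _ _ _ _ mu setT id). Qed.

Lemma expect_indic (mu : {measure set X -> \bar R}) (B : set X) (mB : measurable B) :
  mu [set: X] = 1%E -> expect mu (bm_indic R mB) = fine (mu B).
Proof.
by move=> mu1; rewrite /expect (@comp_integral_indic _ _ _ _ _ mu setT id)// setTI.
Qed.

Lemma expect_ge0 (mu : {measure set X -> \bar R}) f : 0 <=1 f -> 0 <= expect mu f.
Proof. by move=> f0; apply: Rintegral_ge0 => x _; apply: f0. Qed.

Lemma expect1 (mu : {measure set X -> \bar R}) : mu [set: X] = 1%E -> expect mu 1 = 1.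
Proof.
move=> mu1; rewrite /expect.
by have := @Rintegral_cst _ _ _ mu setT measurableT 1; rewrite mu1 mulr1.
Qed.

HB.instance Definition _ (mu : probability X R) :=
  GRing.isLinear.Build R (bmfun R X) R _ (expect mu)
    (expect_scalar (probability_setT mu)).

Variable P : R.-pker X ~> X.

Let P1 x : P x [set: X] = 1%E. Proof. exact: prob_kernel. Qed.

Fact kernel_op_subproof f :
  (fun x => expect (P x) f) \in bounded_measurable (R := R) (X := X).
Proof.
apply/bounded_measurableP; have [C [C0 fC]] := bm_bounded f; split; last first.
  by exists (1 * C) => x; apply: expect_bound.
(* Shifting by [C] makes the integrand nonnegative, the setting in which kernel integrals are known
   to be measurable. *)
have -> : (fun x => expect (P x) f) =
    (fun x => fine (\int[P x]_y (f y + C)%:E)%E - C).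
  apply/funext => x.
  have Plin := expect_scalar (P1 x).
  have := Plin C 1 f; rewrite expect1// mulr1.
  have -> : expect (P x) (C *: (1 : bmfun R X) + f) = fine (\int[P x]_y (f y + C)%:E)%E.
    by rewrite /expect /Rintegral; congr fine; apply: eq_integral => y _;
      rewrite bm_addE bm_scaleE bm_1E mulr1 addrC.
  by move=> ->; rewrite addrAC subrr add0r.
apply: measurable_funB; last exact: measurable_cst.
apply: measurableT_comp; first exact: fine_measurable.
apply: measurable_fun_integral_kernel.
- by move=> U mU; exact: measurable_kernel.
- by move=> y; rewrite lee_fin -lerBlDr sub0r; have := fC y; rewrite ler_norml => /andP[].
- apply/measurable_EFinP; apply: measurable_funD; last exact: measurable_cst.
  exact: bm_measurable.
Qed.

Definition kernel_op f : bmfun R X := BMFun (kernel_op_subproof f).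

Lemma kernel_opE f x : kernel_op f x = expect (P x) f. Proof. by []. Qed.

Fact kernel_op_linear : linear kernel_op.
Proof.
move=> c f g; apply/bmfunP => x; rewrite bm_addE bm_scaleE !kernel_opE.
exact: (expect_scalar (P1 x)).
Qed.
HB.instance Definition _ :=
  GRing.isLinear.Build R (bmfun R X) (bmfun R X) _ kernel_op kernel_op_linear.

Lemma kernel_op_positive : positive_op kernel_op.
Proof. by move=> f f0 x; apply: expect_ge0. Qed.

Lemma kernel_op1 : kernel_op 1 = 1.
Proof. by apply/bmfunP => x; rewrite kernel_opE expect1. Qed.

Lemma kernel_op_minorization (A : set X) (mA : measurable A) (delta : R)
    (nu : probability X R) : 0 < delta ->
  (forall (x : X) (B : set X), measurable B ->
     (delta%:E * (\1_A x)%:E * nu B <= P x B)%E) ->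
  forall f, 0 <=1 f -> (delta * expect nu f) *: bm_indic R mA <=1 kernel_op f.
Proof.
move=> delta0 minor f f0 x; rewrite bm_scaleE bm_indicE kernel_opE -subr_ge0.
have nu1 := probability_setT nu.
pose l (f : bmfun R X) := expect (P x) f - delta * expect nu f * \1_A x.
have i1 : 0 <= (\1_A x : R) <= 1 by rewrite indicE; case: (x \in A); rewrite ?lexx ler01.
apply: (@bounded_functional_ge0 _ _ _ l (1 + delta)) => //.
- by move=> c g k; rewrite /l expect_scalar// (expect_scalar nu1); ring.
- move=> g C gC; apply: le_trans (ler_normB _ _) _; rewrite mulrDl.
  apply: lerD; first exact: expect_bound.
  rewrite !normrM [`|\1_A x|]ger0_norm; last by case/andP: i1.
  rewrite gtr0_norm// -mulrA ler_pM2l//.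
  apply: le_trans (_ : `|expect nu g| <= _).
    by rewrite ler_piMr//; case/andP: i1.
  by have := expect_bound nu1 gC; rewrite mul1r.
- move=> B mB; rewrite /l !expect_indic//.
  rewrite subr_ge0 mulrAC -lee_fin !EFinM fineK ?fin_num_measure//.
  have PB : (P x B <= 1)%E by rewrite -(P1 x); apply: le_measure; rewrite ?inE.
  by rewrite fineK//; [exact: minor|rewrite ge0_fin_numE// (le_lt_trans PB)// ltry].
Qed.

End Kernel.

(** * Reversibility as self-adjointness *)

Section Reversibility.
Context (R : realType) (d : measure_display) (X : measurableType d).
Implicit Types (f g k : bmfun R X).

Lemma expect_mul_scalar (mu : probability X R) (L : bmfun R X -> bmfun R X) k :
  linear L -> scalar (fun f => expect mu (L f * k)).
Proof.
move=> lin c f g; have -> : L (c *: f + g) * k = c *: (L f * k) + L g * k.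
  by apply/bmfunP => x; rewrite lin !(bm_mulE, bm_addE, bm_scaleE); ring.
exact: (expect_scalar (probability_setT mu)).
Qed.

Lemma expect_mul_bound (mu : probability X R) k C f K :
  (forall x, `|k x| <= C) -> (forall x, `|f x| <= K) ->
  `|expect mu (f * k)| <= C * K.
Proof.
move=> kC fK; rewrite -[leRHS]mul1r; apply: expect_bound; first exact: probability_setT.
by move=> x; rewrite bm_mulE normrM mulrC ler_pM.
Qed.

Lemma kernel_op_bound (P : R.-pker X ~> X) f C :
  (forall x, `|f x| <= C) -> forall x, `|kernel_op P f x| <= C.
Proof.
move=> fC x; rewrite kernel_opE -[leRHS]mul1r; apply: expect_bound => //.
exact: prob_kernel.
Qed.

Lemma pker_fin_num (P : R.-pker X ~> X) x (B : set X) : measurable B ->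
  P x B \is a fin_num.
Proof.
move=> mB; rewrite ge0_fin_numE//; apply: le_lt_trans (ltry 1).
by rewrite -(@prob_kernel _ _ _ _ _ P x); apply: le_measure; rewrite ?inE.
Qed.

Lemma expect_kernel_op_indic (P : R.-pker X ~> X) (pi : probability X R)
    (B C : set X) (mB : measurable B) (mC : measurable C) :
  expect pi (kernel_op P (bm_indic R mB) * bm_indic R mC) =
  fine (\int[pi]_(x in C) P x B)%E.
Proof.
rewrite /expect /Rintegral; congr fine; rewrite [RHS]integral_mkcond.
apply: eq_integral => x _.
rewrite bm_mulE kernel_opE expect_indic ?prob_kernel// bm_indicE indicE patchE.
by case: ifP => xC; rewrite ?mulr1 ?mulr0// fineK// pker_fin_num.
Qed.

(** Reversibility on rectangles is extended in one argument at a time, first in [f] against an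
    indicator, then in [k]. *)
Lemma reversible_symmetric (P : R.-pker X ~> X) (pi : probability X R) :
  reversible P pi ->
  forall f k, expect pi (f * kernel_op P k) = expect pi (kernel_op P f * k).
Proof.
move=> rev.
have idl : linear (@idfun (bmfun R X)) by [].
have step f (C : set X) (mC : measurable C) :
   expect pi (f * kernel_op P (bm_indic R mC)) = expect pi (kernel_op P f * bm_indic R mC).
  have [D [_ hD]] := bm_bounded (kernel_op P (bm_indic R mC)).
  have [D' [_ hD']] := bm_bounded (bm_indic R mC).
  apply: (bounded_functional_eq (K1 := D) (K2 := D')
    (expect_mul_scalar pi _ idl) (expect_mul_scalar pi _ (@kernel_op_linear _ _ _ P))).
  - by move=> k K kK; apply: expect_mul_bound.
  - by move=> k K kK; apply: expect_mul_bound => //; exact: kernel_op_bound.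
  - by move=> B mB; rewrite /= mulrC !expect_kernel_op_indic rev.
move=> f k.
have [D [_ hD]] := bm_bounded f; have [D' [_ hD']] := bm_bounded (kernel_op P f).
rewrite [f * _]mulrC [kernel_op P f * _]mulrC.
apply: (bounded_functional_eq (K1 := D) (K2 := D')
    (expect_mul_scalar pi f (@kernel_op_linear _ _ _ P))
    (expect_mul_scalar pi (kernel_op P f) idl)).
- by move=> h K kK; apply: expect_mul_bound => //; exact: kernel_op_bound.
- by move=> h K kK; apply: expect_mul_bound.
- by move=> B mB; rewrite /= mulrC step mulrC.
Qed.

End Reversibility.

(** * A bounded density for a dominated measure *)

Section Density.
Context (R : realType) (d : measure_display) (X : measurableType d).
Variables (pi nu : probability X R) (c : R).
Hypothesis c0 : 0 <= c.
Hypothesis nu_le : forall B, measurable B -> (nu B <= c%:E * pi B)%E.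

Import Radon_Nikodym_SigmaFinite.
Local Notation rn := (Radon_Nikodym_SigmaFinite.f nu pi).

Let nu_pi : nu `<< pi.
Proof.
apply/null_content_dominatesP => B mB piB; apply/eqP.
rewrite eq_le measure_ge0 andbT; apply: le_trans (nu_le mB) _.
by rewrite piB mule0.
Qed.

Let mrn : measurable_fun [set: X] rn.
Proof. exact: measurable_int (f_integrable nu_pi). Qed.

Let mmin : measurable_fun [set: X] (fun x => mine (rn x) c%:E).
Proof. by apply: measurable_mine. Qed.

(* Truncating the density at c loses nothing: on {rn > c} the measures nu and
   c pi squeeze the integral of the truncation. *)
Let truncation (B : set X) : measurable B ->
  nu B = (\int[pi]_(x in B) mine (rn x) c%:E)%E.
Proof.
move=> mB.
have min0 x : (0 <= mine (rn x) c%:E)%E by rewrite le_min f_ge0// lee_fin.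
have le1 D : measurable D -> (\int[pi]_(x in D) mine (rn x) c%:E <= nu D)%E.
  move=> mD; rewrite (f_integral nu_pi mD); apply: ge0_le_integral => //.
  - exact: measurable_funTS.
  - exact: measurable_funTS.
  - by move=> x _; rewrite ge_min lexx.
apply/eqP; rewrite eq_le le1// andbT.
pose N := [set x | (c%:E < rn x)%E].
have mN : measurable N.
  rewrite -[X in measurable X]setTI; apply: emeasurable_fun_lt => //.
have BE : B = (B `&` N) `|` (B `\` N) by rewrite setUIDK.
have mBN : measurable (B `&` N) by exact: measurableI.
have mBD : measurable (B `\` N) by exact: measurableD.
have dis : [disjoint B `&` N & B `\` N].
  by apply/disj_setPS => x [[_ ?] [_ ?]].
rewrite [in leRHS]BE ge0_integral_setU//; last first.
  by rewrite -BE; exact: measurable_funTS.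
rewrite [in leLHS]BE measureU//; last by apply/seteqP; split => x // [[_ ?] [_ ?]].
apply: leeD.
  apply: le_trans (nu_le mBN) _; rewrite -integral_cst//.
  apply: ge0_le_integral => //.
  - exact: measurable_funTS.
  - by move=> x [_ Nx]; rewrite le_min lexx andbT ltW.
have := f_integral nu_pi mBD => /= eB.
apply: le_trans (_ : (\int[pi]_(x in B `\` N) rn x <= _)%E); first by rewrite -eB.
apply: ge0_le_integral => //.
- by move=> x _; exact: f_ge0.
- exact: measurable_funTS.
- exact: measurable_funTS.
- by move=> x [_ Nx]; rewrite le_min lexx /= leNgt; exact/negP.
Qed.

(** Truncating the Radon-Nikodym derivative makes it bounded everywhere rather than almost
    everywhere, so it is a [bmfun] on which P can act. *)
Lemma bounded_density : exists g : bmfun R X,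
  [/\ 0 <=1 g, g <=1 c *: (1 : bmfun R X) &
     forall f, expect nu f = expect pi (g * f)].
Proof.
have g_in : (fun x => fine (mine (rn x) c%:E)) \in bounded_measurable (R := R) (X := X).
  apply/bounded_measurableP; split; first exact: measurableT_comp.
  exists c => x; rewrite ger0_norm; last by rewrite fine_ge0// le_min f_ge0// lee_fin.
  rewrite -lee_fin fineK ?ge_min ?lexx ?orbT//.
  by rewrite /mine; case: ifP => //; rewrite f_fin_num.
pose g := BMFun g_in; exists g.
have gE x : (g x)%:E = mine (rn x) c%:E.
  by rewrite /= /bm_val fineK// /mine; case: ifP => //; rewrite f_fin_num.
split => [x|x|].
- by rewrite -lee_fin gE le_min f_ge0// lee_fin.
- by rewrite bm_scaleE bm_1E mulr1 -lee_fin gE ge_min lexx orbT.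
have [C [C0 gC]] := bm_bounded g.
have idl : linear (@idfun (bmfun R X)) by [].
move=> f; rewrite mulrC; move: f.
apply: (bounded_functional_eq (K1 := 1) (K2 := C)
  (expect_scalar (probability_setT nu)) (expect_mul_scalar pi g idl)).
- by move=> f K fK; apply: expect_bound => //; exact: probability_setT.
- by move=> f K fK; apply: expect_mul_bound.
move=> B mB; rewrite expect_indic; last exact: probability_setT.
transitivity (fine (\int[pi]_(x in B) mine (rn x) c%:E)%E).
  by congr fine; exact: truncation.
rewrite /expect /Rintegral; congr fine; rewrite [LHS]integral_mkcond /=.
apply: eq_integral => x _; rewrite bm_mulE bm_indicE indicE patchE -gE.
by case: ifP => _; rewrite ?mul1r ?mul0r.
Qed.

End Density.

(** * The chain and its hitting times *)

Section Paths.
Context (R : realType) (d dW : measure_display).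
Context (X : measurableType d) (W : measurableType dW).
Variables (P : R.-pker X ~> X) (Pr : X -> probability W R).
Variable Phi : nat -> {mfun W >-> X}.
Hypothesis hPhi : markov_chain P Pr Phi.
Implicit Types (f g : bmfun R X) (D : nat -> set X).

(** Time-dependent sets let one definition cover avoidance of A from time 0, avoidance from time 1,
    and no constraint. The strict bound leaves [Phi n] free. *)
Definition stay D n : set W := [set w | forall i, (i < n)%N -> D i (Phi i w)].

Lemma stay0 D : stay D 0 = [set: W].
Proof. by apply/seteqP; split => w. Qed.

Lemma stayS D n : stay D n.+1 = stay D n `&` Phi n @^-1` D n.
Proof.
apply/seteqP; split => w /=; first by move=> h; split => [i ni|]; apply: h => //; exact: ltnW.
by move=> [h hn] i; rewrite ltnS leq_eqVlt => /predU1P[->|/h].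
Qed.

Lemma natural_filtration_sub n E : natural_filtration Phi n E ->
  natural_filtration Phi n.+1 E.
Proof.
apply: sub_sigma_algebra2 => F [i [B [ni mB ->]]].
by exists i, B; split => //; exact: leqW.
Qed.

Lemma stay_filtration D n : (forall i, measurable (D i)) ->
  natural_filtration Phi n (stay D n.+1).
Proof.
move=> mD.
pose G m := [set E : set W | exists i : nat, exists B : set X,
         [/\ (i <= m)%N, measurable B & E = Phi i @^-1` B]].
have gen m : natural_filtration Phi m (Phi m @^-1` D m).
  by apply: sub_sigma_algebra; exists m, (D m).
elim: n => [|n ih].
  by rewrite stayS stay0 setTI; exact: gen.
rewrite stayS; apply: (@measurableI _ (g_sigma_algebraType (G n.+1))); last exact: gen.
exact: natural_filtration_sub.
Qed.

Lemma stay_measurable D n : (forall i, measurable (D i)) -> measurable (stay D n).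
Proof.
move=> mD; elim: n => [|n ih]; first by rewrite stay0.
rewrite stayS; apply: measurableI => //.
by rewrite -[X in measurable X]setTI; apply: measurable_funP.
Qed.

Lemma markov_step x n (E : set W) f : measurable E -> natural_filtration Phi n E ->
  \int[Pr x]_(w in E) f (Phi n.+1 w) = \int[Pr x]_(w in E) kernel_op P f (Phi n w).
Proof.
move=> mE nE.
have Pr1 : Pr x [set: W] = 1%E := probability_setT _.
have mPhi m : measurable_fun [set: W] (Phi m) by [].
apply: (bounded_functional_eq (K1 := 1) (K2 := 1)
  (l1 := fun f => \int[Pr x]_(w in E) f (Phi n.+1 w))
  (l2 := fun f => \int[Pr x]_(w in E) kernel_op P f (Phi n w))).
- exact: comp_integral_scalar.
- move=> c g k; rewrite linearP.
  exact: (comp_integral_scalar Pr1 mE (mPhi n) c (kernel_op P g) (kernel_op P k)).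
- by move=> g C gC; apply: comp_integral_bound.
- by move=> g C gC; apply: comp_integral_bound => //; exact: kernel_op_bound.
- move=> B mB; rewrite comp_integral_indic//.
  have [_ h] := hPhi x.
  transitivity (fine (\int[Pr x]_(w in E) P (Phi n w) B)%E).
    by congr fine; exact: h.
  rewrite /Rintegral; congr fine; apply: eq_integral => w _.
  by rewrite kernel_opE expect_indic ?prob_kernel// fineK// pker_fin_num.
Qed.

(** Peels off the last step: the constraint at time [n] becomes multiplication by an indicator, so
    path integrals turn into operator iterates. *)
Lemma stay_integral x D (mD : forall i, measurable (D i)) n f :
  \int[Pr x]_(w in stay D n.+1) f (Phi n.+1 w) =
  \int[Pr x]_(w in stay D n) (bm_indic R (mD n) * kernel_op P f) (Phi n w).
Proof.
rewrite markov_step; [|exact: stay_measurable|exact: stay_filtration].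
rewrite stayS /Rintegral integral_mkcondr; congr fine.
apply: eq_integral => w _; rewrite bm_mulE bm_indicE indicE patchE.
rewrite (_ : (w \in Phi n @^-1` D n) = (Phi n w \in D n)); last first.
  by apply/idP/idP; rewrite !inE.
by case: ifP => _; rewrite ?mul1r ?mul0r.
Qed.

Lemma start_integral x f : \int[Pr x]_w f (Phi 0%N w) = f x.
Proof.
have Pr1 : Pr x [set: W] = 1%E := probability_setT _.
have mPhi : measurable_fun [set: W] (Phi 0%N) by [].
apply: (bounded_functional_eq (K1 := 1) (K2 := 1)
  (l1 := fun f => \int[Pr x]_w f (Phi 0%N w)) (l2 := fun f => f x)) => //.
- exact: (comp_integral_scalar Pr1 measurableT mPhi).
- by move=> g C gC; apply: (comp_integral_bound Pr1 measurableT mPhi).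
- by move=> g C gC; rewrite mul1r.
- move=> B mB; rewrite comp_integral_indic// setTI.
  have [h _] := hPhi x.
  transitivity (fine (\d_x B : \bar R)); first by congr fine; exact: h.
  by rewrite diracE bm_indicE indicE.
Qed.

Lemma nstep_expect n x f : expect (nstep Pr Phi n x) f = opow (kernel_op P) n f x.
Proof.
have -> : expect (nstep Pr Phi n x) f = \int[Pr x]_w f (Phi n w).
  have mPhi : measurable_fun [set: W] (Phi n) by [].
  have Pr1 : Pr x [set: W] = 1%E := probability_setT _.
  rewrite /expect /Rintegral; congr fine; rewrite /nstep integral_distribution//.
    by apply/measurable_EFinP; exact: bm_measurable.
  exact: (bm_comp_integrable Pr1 measurableT mPhi).
have mD : forall i : nat, measurable ((fun=> [set: X]) i) by [].
have sT m : stay (fun=> setT) m = [set: W] by apply/seteqP; split => w.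
elim: n f => [|n ih] f; first exact: start_integral.
have := stay_integral x mD n f; rewrite !sT => ->.
rewrite opowSr -ih; apply: eq_Rintegral => w _.
by rewrite bm_mulE bm_indicE indicT mul1r.
Qed.

Variables (A : set X) (mA : measurable A).
Local Notation iA := (bm_indic R mA).
Let mAC (i : nat) : measurable (~` A). Proof. exact: measurableC. Qed.

Lemma avoid_integral n x f :
  \int[Pr x]_(w in stay (fun=> ~` A) n) f (Phi n w) =
  opow (taboo (kernel_op P) iA) n f x.
Proof.
elim: n f => [|n ih] f; first by rewrite stay0 start_integral.
rewrite (stay_integral x mAC) opowSr -ih.
apply: eq_Rintegral => w _; rewrite tabooE bm_mulE !bm_indicE !indicE in_setC.
by case: (_ \in A); rewrite ?subrr ?subr0.
Qed.

Lemma avoid_after_integral n x f :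
  \int[Pr x]_(w in stay (fun i => if i is _.+1 then ~` A else setT) n.+1) f (Phi n.+1 w) =
  kernel_op P (opow (taboo (kernel_op P) iA) n f) x.
Proof.
have mD (i : nat) : measurable (if i is _.+1 then ~` A else setT).
  by case: i => [|i]; [exact: measurableT|exact: measurableC].
elim: n f => [|n ih] f.
  rewrite (stay_integral x mD) stay0 start_integral opow0 bm_mulE bm_indicE.
  by rewrite indicT mul1r.
rewrite (stay_integral x mD) opowSr -ih; apply: eq_Rintegral => w _.
rewrite tabooE bm_mulE !bm_indicE !indicE in_setC.
by case: (_ \in A); rewrite ?subrr ?subr0.
Qed.

(** The k-th indicator is that of sigma_A > k, so the sum is min(sigma_A, N). *)
Lemma sigma_hit_ge (N : nat) (w : W) :
  ((\sum_(k < N) \1_(stay (fun=> ~` A) k.+1) w : R)%:E <= sigma_hit R Phi A w)%E.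
Proof.
apply: le_ereal_inf_tmp => _ [n /= An <-]; rewrite lee_fin.
elim: N => [|N ih]; first by rewrite big_ord0.
rewrite big_ord_recr /=; have [nN|Nn] := leqP n N.
  rewrite [X in _ + X](_ : _ = 0) ?addr0// indicE memNset// => /(_ n).
  by rewrite ltnS nN => /(_ isT).
apply: le_trans (_ : N.+1%:R <= _); last by rewrite ler_nat.
rewrite -natr1; apply: lerD; last by rewrite indicE; case: (_ \in _).
rewrite -[in leRHS](card_ord N) -sumr_const; apply: ler_sum => k _.
by rewrite indicE; case: (_ \in _).
Qed.

(* Spares the measurability of the hitting time. *)
Lemma ge0_le_integral_nonmeasurable (mu : {measure set W -> \bar R}) (f g : W -> \bar R) :
  (forall w, (0 <= f w)%E) -> (forall w, (f w <= g w)%E) ->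
  (\int[mu]_w f w <= \int[mu]_w g w)%E.
Proof.
move=> f0 fg; rewrite !ge0_integralTE//; last first.
  by move=> w; apply: le_trans (f0 w) (fg w).
apply: ereal_sup_le => _ [h hf <-]; exists h => // w.
exact: le_trans (hf w) (fg w).
Qed.

Lemma survival_sum_le (M : R) :
  ereal_sup (range (fun x : X => \int[Pr x]_w sigma_hit R Phi A w)%E) = M%:E ->
  forall N x, \sum_(k < N) opow (taboo (kernel_op P) iA) k.+1 1 x <= M.
Proof.
move=> hM N x.
have mS k : measurable (stay (fun=> ~` A) k) by exact: stay_measurable.
have e k : opow (taboo (kernel_op P) iA) k.+1 1 x = fine (Pr x (stay (fun=> ~` A) k.+1)).
  by rewrite -avoid_integral Rintegral_cst// mul1r.
rewrite -lee_fin -hM.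
apply: le_trans (ereal_sup_ubound _); last by exists x.
apply: le_trans (ge0_le_integral_nonmeasurable (f := fun w =>
  ((\sum_(k < N) \1_(stay (fun=> ~` A) k.+1) w : R)%:E)) _ _ _); last first.
- exact: sigma_hit_ge.
- by move=> w; rewrite lee_fin; apply: sumr_ge0 => k _; rewrite indicE.
under eq_integral do rewrite -sumEFin.
rewrite ge0_integral_sum//; last first.
  by move=> k; apply/measurable_EFinP; apply: measurable_indic.
rewrite -sumEFin; apply: lee_sum => k _.
by rewrite integral_indic// setIT e fineK// fin_num_measure.
Qed.

Lemma first_returnE n x :
  first_return Pr Phi n.+1 x A = (kernel_op P (opow (taboo (kernel_op P) iA) n iA) x)%:E.
Proof.
rewrite -avoid_after_integral.
set D := (fun i : nat => if i is _.+1 then ~` A else setT).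
have mD (i : nat) : measurable (D i).
  by case: i => [|i]; [exact: measurableT|exact: measurableC].
have Pr1 : Pr x [set: W] = 1%E := probability_setT _.
rewrite comp_integral_indic//; last exact: stay_measurable.
have mAP : measurable (Phi n.+1 @^-1` A).
  by rewrite -[X in measurable X]setTI; apply: measurable_funP.
rewrite fineK; last first.
  by rewrite fin_num_measure//; apply: measurableI => //; exact: stay_measurable.
rewrite /first_return; congr (Pr x _).
apply/seteqP; split => w /=.
- rewrite /tau_hit => tau.
  set S := (X in ereal_inf X) in tau.
  have lb m : (1 <= m)%N -> A (Phi m w) -> (n.+1 <= m)%N.
    move=> m1 Am; rewrite -(ler_nat R) -lee_fin -tau; apply: ereal_inf_lbound.
    by exists m.
  split.
    by case=> [//|i] /=; rewrite ltnS => ni Ai; have := lb i.+1 isT Ai; rewrite ltnS leqNgt ni.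
  (* Without a visit at [n.+1], every visit would come at [n.+2] or later, and so would the
     infimum. *)
  apply: contrapT => nA.
  have : ((n.+2%:R : R)%:E <= (n.+1%:R : R)%:E)%E.
    rewrite -tau; apply: le_ereal_inf_tmp => _ [m [m1 Am] <-].
    rewrite lee_fin ler_nat ltn_neqAle lb// andbT; apply/eqP => nm.
    by apply: nA; rewrite nm.
  by rewrite lee_fin ler_nat ltnn.
- move=> [stayw Aw]; apply/eqP; rewrite eq_le; apply/andP; split.
    by apply: ereal_inf_lbound; exists n.+1.
  apply: le_ereal_inf_tmp => _ [m [m1 Am] <-]; rewrite lee_fin ler_nat leqNgt.
  by apply/negP => mn; case: m m1 Am mn => // m _ Am /stayw /=.
Qed.

End Paths.

(** * The even return times *)

Section FirstReturn.
Context (R : realType) (d dW : measure_display).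
Context (X : measurableType d) (W : measurableType dW).
Variables (P : R.-pker X ~> X) (Pr : X -> probability W R).
Variable Phi : nat -> {mfun W >-> X}.
Hypothesis hPhi : markov_chain P Pr Phi.
Variables (A : set X) (mA : measurable A) (lam theta : R).
Hypothesis lam0 : 0 <= lam.
Hypothesis hF : (ereal_sup
             [set \sum_(1 <= n <oo)
                     ((lam ^+ (2 * n))%:E * first_return Pr Phi (2 * n) x A)
                | x in A] <= theta%:E)%E.

Lemma sum_odd (c : nat -> R) N :
  \sum_(k < N | odd k == true) c k = \sum_(1 <= n < N./2.+1) c (2 * n).-1.
Proof.
elim: N => [|N ih]; first by rewrite big_ord0 big_geq.
rewrite big_mkcond big_ord_recr -big_mkcond ih /= uphalf_half.
have [oN|eN] := boolP (odd N) => /=; last by rewrite addr0.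
rewrite add1n [RHS]big_nat_recr//; congr (_ + c _).
by rewrite mul2n doubleS /= -[LHS]odd_double_half oN add1n.
Qed.

Let term_ge0 n x : (0 <= (lam ^+ (2 * n))%:E * first_return Pr Phi (2 * n) x A)%E.
Proof. by rewrite mule_ge0// lee_fin exprn_ge0. Qed.

Let series_le x : A x ->
  (\sum_(1 <= n <oo) ((lam ^+ (2 * n))%:E * first_return Pr Phi (2 * n) x A)
    <= theta%:E)%E.
Proof. by move=> Ax; apply: le_trans hF; apply: ereal_sup_ubound; exists x. Qed.

Lemma even_return_ge0 : A !=set0 -> 0 <= theta.
Proof.
move=> [x Ax]; rewrite -lee_fin; apply: le_trans (series_le Ax).
exact: nneseries_ge0.
Qed.

(** A return at time 2n is a hit at the odd time 2n - 1 seen after one step, so the left side is a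
    partial sum of the series in [hF], whose terms are nonnegative. *)
Lemma even_return_le N x : A x ->
  lam * kernel_op P (hit_par (kernel_op P) (bm_indic R mA) lam true N) x <= theta.
Proof.
move=> Ax; rewrite -lee_fin; apply: le_trans (series_le Ax).
rewrite hit_parE linear_sum bm_sumE mulr_sumr.
under eq_bigr do rewrite linearZ bm_scaleE mulrA -exprS.
rewrite (sum_odd (fun k => lam ^+ k.+1 *
  kernel_op P (opow (taboo (kernel_op P) (bm_indic R mA)) k (bm_indic R mA)) x)).
apply: le_trans (nneseries_lim_ge N./2.+1 _); last by move=> n _ _; exact: term_ge0.
rewrite -sumEFin le_eqVlt; apply/orP; left; apply/eqP.
apply: eq_big_nat => -[//|n] _; rewrite mulnS add2n /= EFinM.
by rewrite (first_returnE hPhi mA).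
Qed.

End FirstReturn.

(** * From the chain to the abstract bound *)

Lemma lt_expeR_inv (R : realType) (M lambda : R) : 0 <= M -> 0 < lambda ->
  (lambda%:E < expeR (M%:E)^-1)%E -> M * ln lambda < 1.
Proof.
rewrite le_eqVlt => /predU1P[<-|M0] lambda0; first by rewrite mul0r ltr01.
rewrite inver gt_eqF//= lte_fin => h.
by rewrite mulrC -ltr_pdivlMr// div1r -[ltRHS]expRK ltr_ln// posrE expR_gt0.
Qed.

(* (M%:E)^-1 is +oo for M = 0, and then expeR gives +oo. *)
Theorem theorem4p2 (R : realType) (d dW : measure_display)
    (X : measurableType d) (W : measurableType dW)
    (P : R.-pker X ~> X) (pi : probability X R)
    (Pr : X -> probability W R) (Phi : nat -> {mfun W >-> X})
    (hX : countably_generated X)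
    (hPhi : markov_chain P Pr Phi)
    (hinv : invariant_measure P pi)
    (hirr : pi_irreducible Pr Phi pi)
    (hac : forall (n : nat) (x : X), (1 <= n)%N -> nstep Pr Phi n x `<< pi)
    (hrev : reversible P pi)
    (A : set X) (mA : measurable A) (hA : (0 < pi A)%E)
    (delta : R) (hdelta : 0 < delta) (nu : probability X R)
    (hminor : forall (x : X) (B : set X), measurable B ->
       (delta%:E * (\1_A x)%:E * nu B <= P x B)%E)
    (M : R)
    (hM : ereal_sup (range (fun x : X => \int[Pr x]_w sigma_hit R Phi A w)%E)
          = M%:E)
    (lambda theta : R)
    (hlambda1 : 1 < lambda)
    (hlambdaM : (lambda%:E < expeR (M%:E)^-1)%E)
    (htheta1 : theta < 1)
    (hF : (ereal_sup
             [set \sum_(1 <= n <oo)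
                     ((lambda ^+ (2 * n))%:E * first_return Pr Phi (2 * n) x A)
                | x in A] <= theta%:E)%E)
    (hlambda : lambda ^+ 2 <
       (1 - theta) * (1 - M * ln lambda) ^+ 2
         * (1 + delta ^+ 2 * fine (nu A) * lambda ^+ 2)) :
  let C3 : R := Num.sqrt ((delta ^+ 2 * fine (nu A) * fine (pi A))^-1 - 1) in
  let M3 : R := delta ^+ 2 * fine (nu A) * lambda ^+ 2
       / ((1 - theta) * (1 - M * ln lambda) ^+ 2
            * (1 + delta ^+ 2 * fine (nu A) * lambda ^+ 2) - lambda ^+ 2) in
  let D3 : R := C3 * lambda + Num.max (2 - C3) 0 * lambda^-1 * M3 in
  let E3 : R := C3 * (lambda - lambda^-1) * M3 / 2 in
  forall n : nat,
    (unif_var_dist (nstep Pr Phi n) pi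
       <= ((D3 + E3 * n%:R) * lambda ^- n)%:E)%E.
Proof.
move=> C3 M3 D3 E3 n.
pose iA := bm_indic R mA.
have lam0 : 0 < lambda by exact: lt_trans hlambda1.
have pi_T : pi [set: X] = 1%E := probability_setT pi.
have nu_T : nu [set: X] = 1%E := probability_setT nu.
have piAE : expect pi iA = fine (pi A) by exact: expect_indic.
have nuAE : expect nu iA = fine (nu A) by exact: expect_indic.
have piA0 : 0 < expect pi iA.
  by rewrite piAE fine_gt0// hA/= (le_lt_trans (probability_le1 _ mA)) ?ltry.
have A0 : A !=set0.
  apply/set0P; apply: contraTneq hA => ->; by rewrite measure0 ltxx.
have Ppos := @kernel_op_positive _ _ _ P.
have P1 := kernel_op1 P.
have iA01 x : iA x = 0 \/ iA x = 1.
  by rewrite bm_indicE indicE; case: (x \in A); [right|left].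
have pi1 : expect pi 1 = 1 by exact: expect1.
have nu1 : expect nu 1 = 1 by exact: expect1.
have sym := reversible_symmetric hrev.
have minor := kernel_op_minorization mA hdelta hminor.
have surv := survival_sum_le hPhi mA hM.
have M0 : 0 <= M by have := surv 0 point; rewrite big_ord0.
have Mlam := lt_expeR_inv M0 lam0 hlambdaM.
have theta0 : 0 <= theta := even_return_ge0 (ltW lam0) hF A0.
have htheta N x : iA x = 1 ->
    lambda * kernel_op P (hit_par (kernel_op P) iA lambda true N) x <= theta.
  rewrite bm_indicE indicE; have [xA _|] := boolP (x \in A).
    by apply: (even_return_le hPhi mA (ltW lam0) hF); exact/set_mem.
  by move=> _ /esym/eqP; rewrite oner_eq0.
rewrite -nuAE in hlambda C3 M3 D3 E3 *; rewrite -piAE in C3 D3 E3 *.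
have nupos := @expect_ge0 _ _ _ nu.
have pipos := @expect_ge0 _ _ _ pi.
have iApos : 0 <=1 iA by move=> x; case: (iA01 x) => ->.
(* The condition on [lambda] forces nu(A) > 0. *)
have a0 : 0 < delta ^+ 2 * expect nu iA.
  apply: minorization_mass_gt0 hlambda => //.
  - by rewrite mulr_ge0 ?sqr_ge0// nupos.
  - by rewrite subr_gt0.
  - by rewrite gerBl mulr_ge0// ln_ge0// ltW.
set a := delta ^+ 2 * expect nu iA in a0.
have aA0 : 0 < a * expect pi iA by rewrite mulr_gt0.
(* Integrating the two-step minorization of the indicator of B against the invariant pi gives a
   pi(A) nu(B) <= pi(B). *)
have nu_le B : measurable B -> (nu B <= (a * expect pi iA)^-1%:E * pi B)%E.
  move=> mB; have B0 : 0 <=1 bm_indic R mB.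
    by move=> x; rewrite bm_indicE indicE.
  have := functional_le pipos (minorization2 Ppos iA01 nupos hdelta minor B0).
  rewrite linearZ /= (invariant_opow P1 sym) /=.
  rewrite (expect_indic mB pi_T) (expect_indic mB nu_T) -/a => h.
  rewrite -(fineK (fin_num_measure nu _ mB)) -(fineK (fin_num_measure pi _ mB)).
  rewrite -EFinM lee_fin mulrC ler_pdivlMr//; apply: le_trans h.
  by rewrite mulrCA mulrA.
have c0 : 0 <= (a * expect pi iA)^-1 by rewrite invr_ge0 ltW.
have [g [_ g_le density]] := bounded_density c0 nu_le.
apply: ub_ereal_sup => _ [x _ <-]; apply: ub_ereal_sup => _ [f [mf f1] <-].
rewrite lee_fin.
have f_in : f \in bounded_measurable (R := R) (X := X).
  by apply/bounded_measurableP; split => //; exists 1.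
have devi := deviation_le Ppos P1 iA01 pipos pi1 nupos nu1 sym hdelta hlambda1
  minor surv Mlam theta0 htheta1 htheta hlambda piA0 density g_le n x (f := BMFun f_in) f1.
rewrite -(nstep_expect hPhi) in devi.
exact: devi.
Qed.
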